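(* Let $k$ be an ordered field. The $\mathcal{L}_k$-theory of closed $H$-triples over $k$ has quantifier elimination.
   Context: Ordered sets, groups and fields are totally ordered. For an ordered abelian group $\Gamma$: $\Gamma^{\ne}=\Gamma\setminus\{0\}$, $\Gamma^{>}=\{\gamma\in\Gamma:\gamma>0\}$. An ordered vector space over $k$ is an ordered abelian group that is a $k$-vector space with $c\gamma>0$ for all $c>0$ in $k$, $\gamma\in\Gamma^{>}$. An $H$-couple is a pair $(\Gamma,\psi)$, $\Gamma$ an ordered abelian group, $\psi\colon\Gamma^{\ne}\to\Gamma$, such that for all $\alpha,\beta\in\Gamma^{\ne}$: (AC1) $\alpha+\beta\ne0\Rightarrow\psi(\alpha+\beta)\ge\min(\psi(\alpha),\psi(\beta))$; (AC2) $\psi(m\alpha)=\psi(\alpha)$ for all nonzero integers $m$; (AC3) $\alpha>0\Rightarrow\alpha+\psi(\alpha)>\psi(\beta)$; (HC) $0<\alpha\le\beta\Rightarrow\psi(\alpha)\ge\psi(\beta)$. An $H$-couple over $k$ is one where $\Gamma$ is also an ordered vector space over $k$ and $\psi(c\gamma)=\psi(\gamma)$ for all $c\in k^\times$, $\gamma\in\Gamma^{\ne}$. Put $\Psi=\psi(\Gamma^{\ne})$, $\gamma'=\gamma+\psi(\gamma)$ for $\gamma\ne0$, $S'=\{\gamma':\gamma\in S\}$. $(\Gamma,\psi)$ is closed if $\Gamma$ is divisible, $\Psi$ is downward closed in $\Gamma$, and $\Gamma=(\Gamma^{\ne})'$. An $H$-cut in $(\Gamma,\psi)$ is a downward closed $P\subseteq\Gamma$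 with $\Psi\subseteq P<(\Gamma^{>})'$ (every element of $P$ less than every element of $(\Gamma^{>})'$). An $H$-triple over $k$ is $(\Gamma,\psi,P)$ with $(\Gamma,\psi)$ an $H$-couple over $k$ and $P$ an $H$-cut in it; it is closed if $(\Gamma,\psi)$ is closed. $\mathcal{L}_k$ is the one-sorted language of ordered vector spaces over $k$ ($<,0,-,+$, and a unary function symbol for scalar multiplication by each $c\in k$) augmented by a constant symbol $\infty$, a unary function symbol $\psi$, and a unary relation symbol $P$. An $H$-triple over $k$ is construed as an $\mathcal{L}_k$-structure with underlying set $\Gamma_\infty=\Gamma\cup\{\infty\}$, ordered with $\gamma<\infty$ for $\gamma\in\Gamma$, and with $\infty$ as default value: $\psi(0)=\psi(\infty)=\gamma+\infty=\infty+\gamma=\infty+\infty=-\infty=c\infty=\infty$ for $\gamma\in\Gamma$, $c\in k$. *)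

(* Defs.v *)
From HB Require Import structures.
From mathcomp Require Import all_boot all_order all_algebra.
From mathcomp Require Import boolp classical_sets.

Set Implicit Arguments.
Unset Strict Implicit.
Unset Printing Implicit Defensive.

Import Order.TTheory GRing.Theory Num.Theory.
Local Open Scope classical_set_scope.
Local Open Scope ring_scope.

(** * Ordered abelian groups and ordered vector spaces *)

(* [porderZmodType] is a bare join of a partial order and an abelian group,
   without compatibility axiom.  Totality is a field of the mixin, rather than
   inherited from [orderType], because hierarchy-builder would otherwise ask for
   a structure placed below the already declared [realDomainType]. *)
HB.mixin Record POrderedZmodule_isOrderedGroup V of Num.POrderedZmodule V := {
  le_total_group : forall x y : V, (x <= y) || (y <= x);
  ler_translate : forall x y z : V, x <= y -> z + x <= z + y
}.

#[short(type="orderedZmodType")]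
HB.structure Definition OrderedZmodule :=
  { V of Num.POrderedZmodule V & POrderedZmodule_isOrderedGroup V }.

HB.mixin Record Lmodule_isOrderedVect (k : realFieldType) V
    of GRing.Lmodule k V & OrderedZmodule V := {
  scaler_pos : forall (c : k) (x : V), 0 < c -> 0 < x -> 0 < c *: x
}.

#[short(type="orderedVectType")]
HB.structure Definition OrderedVect (k : realFieldType) :=
  { V of GRing.Lmodule k V & OrderedZmodule V & Lmodule_isOrderedVect k V }.

(** * H-couples and H-triples *)

(* The map psi, which is only given on the nonzero elements, is represented by
   a total function whose value at 0 is irrelevant: everything below only
   depends on the values of psi at nonzero arguments. *)

Definition nonzero (G : orderedZmodType) : set G := [set g | g != 0].
Definition positive (G : orderedZmodType) : set G := [set g | 0 < g].

Definition downward_closed (G : orderedZmodType) (S : set G) : Prop :=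
  forall x y : G, S y -> x <= y -> S x.

Definition divisible (G : orderedZmodType) : Prop :=
  forall (n : nat) (g : G), (0 < n)%N -> exists d : G, d *+ n = g.

Record H_couple (G : orderedZmodType) (psi : G -> G) : Prop := {
  AC1 : forall a b, a != 0 -> b != 0 -> a + b != 0 ->
          Order.min (psi a) (psi b) <= psi (a + b);
  AC2 : forall a (m : int), a != 0 -> m != 0 -> psi (a *~ m) = psi a;
  AC3 : forall a b, a != 0 -> b != 0 -> 0 < a -> psi b < a + psi a;
  HC  : forall a b, a != 0 -> b != 0 -> 0 < a -> a <= b -> psi b <= psi a
}.

Definition Psi (G : orderedZmodType) (psi : G -> G) : set G :=
  psi @` @nonzero G.

Definition prime_image (G : orderedZmodType) (psi : G -> G) (S : set G) :
  set G := [set g + psi g | g in S].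

Record closed_couple (G : orderedZmodType) (psi : G -> G) : Prop := {
  closed_divisible : divisible G;
  closed_Psi : downward_closed (Psi psi);
  closed_prime : [set: G] = prime_image psi (@nonzero G)
}.

Record H_couple_over (k : realFieldType) (G : orderedVectType k)
    (psi : G -> G) : Prop := {
  H_couple_over_couple : H_couple psi;
  H_couple_over_scale :
    forall (c : k) (g : G), c != 0 -> g != 0 -> psi (c *: g) = psi g
}.

Record H_cut (G : orderedZmodType) (psi : G -> G) (P : set G) : Prop := {
  H_cut_down : downward_closed P;
  H_cut_Psi : Psi psi `<=` P;
  H_cut_lt : forall p q, P p -> prime_image psi (@positive G) q -> p < q
}.

Record H_triple (k : realFieldType) (G : orderedVectType k)
    (psi : G -> G) (P : set G) : Prop := {
  H_triple_couple : H_couple_over psi;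
  H_triple_cut : H_cut psi P
}.

Definition closed_H_triple (k : realFieldType) (G : orderedVectType k)
    (psi : G -> G) (P : set G) : Prop :=
  H_triple psi P /\ closed_couple psi.

(** * The first-order language L_k *)

(* Well-scoped de Bruijn syntax: the free variables of a term or formula of
   index [n] are among ['I_n], and a quantifier binds the variable [ord0] of
   its body.  Sentences are the elements of [formula k 0]. *)

Inductive term (k : Type) (n : nat) : Type :=
| Var of 'I_n
| Zero
| Infty
| Opp of term k n
| Add of term k n & term k n
| Scale of k & term k n
| PsiT of term k n.

Inductive formula (k : Type) : nat -> Type :=
| Bot n : formula k n
| Eq n : term k n -> term k n -> formula k n
| Lt n : term k n -> term k n -> formula k n
| InP n : term k n -> formula k n
| Not n : formula k n -> formula k n
| And n : formula k n -> formula k n -> formula k n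
| Or n : formula k n -> formula k n -> formula k n
| Imp n : formula k n -> formula k n -> formula k n
| Ex n : formula k n.+1 -> formula k n
| All n : formula k n.+1 -> formula k n.

Definition sentence (k : Type) := formula k 0.

Fixpoint quantifier_free (k : Type) (n : nat) (f : formula k n) : bool :=
  match f with
  | Bot _ | Eq _ _ _ | Lt _ _ _ | InP _ _ => true
  | Not _ g => quantifier_free g
  | And _ g h | Or _ g h | Imp _ g h => quantifier_free g && quantifier_free h
  | Ex _ _ | All _ _ => false
  end.

Record structure (k : Type) : Type := Structure {
  carrier :> Type;
  s_zero : carrier;
  s_infty : carrier;
  s_opp : carrier -> carrier;
  s_add : carrier -> carrier -> carrier;
  s_scale : k -> carrier -> carrier;
  s_psi : carrier -> carrier;
  s_lt : carrier -> carrier -> Prop;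
  s_P : carrier -> Prop
}.

Fixpoint eval (k : Type) (M : structure k) (n : nat) (v : 'I_n -> M)
    (t : term k n) : M :=
  match t with
  | Var i => v i
  | Zero => s_zero M
  | Infty => s_infty M
  | Opp t1 => s_opp (eval v t1)
  | Add t1 t2 => s_add (eval v t1) (eval v t2)
  | Scale c t1 => s_scale c (eval v t1)
  | PsiT t1 => s_psi (eval v t1)
  end.

Definition extend (A : Type) (n : nat) (a : A) (v : 'I_n -> A) (i : 'I_n.+1) :
  A := if unlift ord0 i is Some j then v j else a.

Fixpoint sat (k : Type) (M : structure k) (n : nat) (f : formula k n) :
    ('I_n -> M) -> Prop :=
  match f in formula _ n return ('I_n -> M) -> Prop with
  | Bot _ => fun _ => False
  | Eq _ t u => fun v => eval v t = eval v u
  | Lt _ t u => fun v => s_lt (eval v t) (eval v u)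
  | InP _ t => fun v => s_P (eval v t)
  | Not _ g => fun v => ~ sat g v
  | And _ g h => fun v => sat g v /\ sat h v
  | Or _ g h => fun v => sat g v \/ sat h v
  | Imp _ g h => fun v => sat g v -> sat h v
  | Ex _ g => fun v => exists a : M, sat g (extend a v)
  | All _ g => fun v => forall a : M, sat g (extend a v)
  end.

Definition no_var (A : Type) (i : 'I_0) : A :=
  False_rect A (notF (ltn_ord i)).

Definition holds (k : Type) (M : structure k) (s : sentence k) : Prop :=
  sat s (@no_var M).

Definition model (k : Type) (T : set (sentence k)) (M : structure k) : Prop :=
  forall s, T s -> holds M s.

Definition has_QE (k : Type) (T : set (sentence k)) : Prop :=
  forall (n : nat) (f : formula k n),
    exists g : formula k n, quantifier_free g /\
      forall M : structure k, model T M ->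
        forall v : 'I_n -> M, sat f v <-> sat g v.

(** * H-triples as L_k-structures *)

(* The underlying set is [option G], with [None] in the role of infinity. *)
Section StructureOf.
Variables (k : realFieldType) (G : orderedVectType k).
Variables (psi : G -> G) (P : set G).

Definition lt_infty (x y : option G) : Prop :=
  match x, y with
  | Some a, Some b => a < b
  | Some _, None => True
  | None, _ => False
  end.

Definition add_infty (x y : option G) : option G :=
  if (x, y) is (Some a, Some b) then Some (a + b) else None.

Definition psi_infty (x : option G) : option G :=
  if x is Some a then (if a == 0 then None else Some (psi a)) else None.

Definition H_structure : structure k := {|
  carrier := option G;
  s_zero := Some 0;
  s_infty := None;
  s_opp := omap (fun a => - a);
  s_add := add_infty;
  s_scale := fun c => omap (fun a => c *: a);
  s_psi := psi_infty;
  s_lt := lt_infty;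
  s_P := fun x => if x is Some a then P a else False
|}.

End StructureOf.

(* The set of all L_k-sentences true in every closed H-triple over k. *)
Definition closed_H_triples_theory (k : realFieldType) : set (sentence k) :=
  [set s | forall (G : orderedVectType k) (psi : G -> G) (P : set G),
     closed_H_triple psi P -> holds (H_structure psi P) s].

(* Main.v *)
(* Write x' = x + psi x.  By compactness (an ultraproduct over finite sets of
   formulas), it suffices to show: if tuples a, b in closed H-triples M, N have
   the same quantifier-free type, then any quantifier-free formula phi(x, a)
   solvable in M has a solution phi(y, b) in N.

   Extend the isomorphism from <a> to <b> by Zorn to a maximal partial
   isomorphism R.  Its domain A is then closed under integration (solving
   y' = a) and under psi-preimages of elements of P, because the quantifier-free
   type of such a solution over A is determined.

   So only this remains: phi(x, a) with x in M \ A and a in A is already solvable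
   in A.  Follow the chain x_0 = x, x_(i+1) = psi (x_i - a_i), with a_i in A such
   that x_(i+1) is not in A, as long as possible.  The values psi (x_i - a_i)
   strictly increase, so the terms in x are the linear combinations of A and the
   x_i, and their signs, psi-values and membership in P are governed by the cuts
   of the x_i over A, by the values psi (x_n - a) if the chain stops at x_n, and
   by the membership in P of at most one further element A + k x_n.  Any finite
   part of this information is realized in A, working from the end of the chain
   down to x_0. *)
Require Import Defs.
From HB Require Import structures.
From mathcomp Require Import all_boot all_order all_algebra.
From mathcomp Require Import boolp classical_sets filter.

Set Implicit Arguments.
Unset Strict Implicit.
Unset Printing Implicit Defensive.

Import Order.TTheory GRing.Theory Num.Theory.
Local Open Scope ring_scope.

(** * Ordered groups and H-couples *)

(** The domain A of a maximal R is itself a closed triple inside M, so a solution found in A is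
    carried to N by R; no saturation of N is needed. In a closed triple [P] is just Psi; it matters
    on substructures, because P (u') holds exactly for u < 0: it records the sign of an integral
    that the substructure may lack.

    Nearly all computations rest on one principle: if psi x < psi y, then y is negligible in x + y,
    for the value of psi and for the sign.

    The delicate point is membership in [P] of an element of A + k x_n whose integral u is missing
    from the generated structure. Then u is infinitesimal over that structure, and the cut of x_n
    over A does not show its sign. The approximation has to be steered: the element is replaced by
    e' with e in A tiny and of the sign of u. *)

Section OrderedGroup.
Variable G : orderedZmodType.
Implicit Types x y z : G.

Lemma og_leNgt x y : (x <= y) = ~~ (y < x).
Proof.
rewrite lt_def negb_and negbK.
case/orP: (le_total_group x y) => [xy|yx]; first by rewrite xy eq_le xy /= orbN.
rewrite yx /= orbF; apply/idP/eqP => [xy|->//].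
by apply/eqP; rewrite eq_le xy yx.
Qed.

Lemma og_ltNge x y : (x < y) = ~~ (y <= x).
Proof. by rewrite og_leNgt negbK. Qed.

Variant og_cmp x y : Prop :=
| OgLt of x < y | OgEq of x = y | OgGt of y < x.

Lemma og_ltgtP x y : og_cmp x y.
Proof.
case: (boolP (x < y)) => [/OgLt//|]; rewrite -og_leNgt le_eqVlt.
by case/orP=> [/eqP/esym/OgEq|/OgGt].
Qed.

Lemma og_leD2l z x y : (z + x <= z + y) = (x <= y).
Proof.
apply/idP/idP => [|/ler_translate]; last exact.
by move/(ler_translate _ _ (- z)); rewrite !addKr.
Qed.

Lemma og_ltD2l z x y : (z + x < z + y) = (x < y).
Proof. by rewrite !og_ltNge og_leD2l. Qed.

Lemma og_leD2r z x y : (x + z <= y + z) = (x <= y).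
Proof. by rewrite ![_ + z]addrC og_leD2l. Qed.

Lemma og_ltD2r z x y : (x + z < y + z) = (x < y).
Proof. by rewrite ![_ + z]addrC og_ltD2l. Qed.

Lemma og_subr_gt0 x y : (0 < y - x) = (x < y).
Proof. by rewrite -[LHS](og_ltD2r x) add0r subrK. Qed.

Lemma og_subr_lt0 x y : (y - x < 0) = (y < x).
Proof. by rewrite -[LHS](og_ltD2r x) add0r subrK. Qed.

Lemma og_subr_ge0 x y : (0 <= y - x) = (x <= y).
Proof. by rewrite -[LHS](og_leD2r x) add0r subrK. Qed.

Lemma og_oppr_gt0 x : (0 < - x) = (x < 0).
Proof. by rewrite -sub0r og_subr_gt0. Qed.

Lemma og_addr_lt0 x y : x < 0 -> y < 0 -> x + y < 0.
Proof. by move=> x0 y0; rewrite (lt_trans _ x0)// -{2}[x]addr0 og_ltD2l. Qed.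

Lemma og_lt0 x : x != 0 -> (x < 0) = ~~ (0 < x).
Proof. by move=> x0; rewrite -og_leNgt lt_neqAle x0. Qed.

Lemma og_gt0N x : x != 0 -> (0 < - x) = ~~ (0 < x).
Proof. by move=> x0; rewrite og_oppr_gt0 og_lt0. Qed.

End OrderedGroup.

Section OrderedVect.
Variables (k : realFieldType) (G : orderedVectType k).
Implicit Types x y : G.

Lemma ov_pscale_gt0 (c : k) x : 0 < c -> (0 < c *: x) = (0 < x).
Proof.
move=> c0; apply/idP/idP => [|]; last exact: scaler_pos.
move/(@scaler_pos k G c^-1 _); rewrite invr_gt0 => /(_ c0).
by rewrite scalerA mulVf ?scale1r// gt_eqF.
Qed.

Lemma ov_nscale_gt0 (c : k) x : c < 0 -> (0 < c *: x) = (x < 0).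
Proof.
move=> c0; rewrite -[c]opprK scaleNr -scalerN ov_pscale_gt0 ?oppr_gt0//.
exact: og_oppr_gt0.
Qed.

Lemma ov_scale_neq0 (c : k) x : c != 0 -> x != 0 -> c *: x != 0.
Proof. by move=> c0 x0; rewrite scaler_eq0 negb_or c0. Qed.

Lemma ov_scale_gt0 (c : k) x : c != 0 -> x != 0 ->
  (0 < c *: x) = ((0 < c) == (0 < x)).
Proof.
move=> c0 x0; case: (ltrgtP c 0) => cc; last by rewrite cc eqxx in c0.
  by rewrite ov_nscale_gt0// og_lt0//; case: (0 < x).
by rewrite ov_pscale_gt0//; case: (0 < x).
Qed.

Definition ov_half x := (2%:R^-1 : k) *: x.

Lemma ov_halfD x : ov_half x + ov_half x = x.
Proof.
rewrite /ov_half -scalerDl -mulr2n -[_ *+ 2]mulr_natr mulVf ?scale1r//.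
by rewrite pnatr_eq0.
Qed.

Lemma ov_half_gt0 x : (0 < ov_half x) = (0 < x).
Proof. by rewrite ov_pscale_gt0// invr_gt0 ltr0n. Qed.

Record subspace (S : set G) : Prop := Subspace {
  subspace0 : S 0;
  subspaceD : forall x y, S x -> S y -> S (x + y);
  subspaceZ : forall (c : k) x, S x -> S (c *: x)
}.

Lemma subspaceN S x : subspace S -> S x -> S (- x).
Proof. by move=> sS Sx; rewrite -scaleN1r; apply: subspaceZ. Qed.

Lemma subspaceB S x y : subspace S -> S x -> S y -> S (x - y).
Proof. by move=> sS Sx Sy; apply: subspaceD => //; apply: subspaceN. Qed.

Lemma subspace_scale_notin S (c : k) x :
  subspace S -> c != 0 -> ~ S x -> ~ S (c *: x).
Proof.
move=> sS c0 nSx Scx; apply: nSx.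
by rewrite -(scale1r x) -(mulVf c0) -scalerA; apply: subspaceZ.
Qed.

End OrderedVect.

Section Couple.
Variables (k : realFieldType) (G : orderedVectType k) (psi : G -> G).
Hypothesis Hpsi : H_couple_over psi.
Implicit Types x y z : G.
Let Hc := H_couple_over_couple Hpsi.

Lemma psiZ (c : k) x : c != 0 -> x != 0 -> psi (c *: x) = psi x.
Proof. exact: H_couple_over_scale. Qed.

Lemma psiN x : x != 0 -> psi (- x) = psi x.
Proof. by move=> x0; rewrite -scaleN1r psiZ// oppr_eq0 oner_eq0. Qed.

Lemma psiB x y : x != y -> psi (x - y) = psi (y - x).
Proof. by move=> xy; rewrite -opprB psiN// subr_eq0 eq_sym. Qed.

(* [y = 0] counts as infinitesimal with respect to every [x]. *)
Definition dominated x y := y != 0 -> psi x < psi y.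

(** If u > 0 and u + v <= 0, then u <= - v and (HC) gives psi v <= psi u; this settles the sign. For
    the value, (AC1) is applied to x + y and, conversely, to x = (x + y) - y. *)
Lemma dominated_add x y : x != 0 -> dominated x y ->
  [/\ x + y != 0, psi (x + y) = psi x & (0 < x + y) = (0 < x)].
Proof.
rewrite /dominated => x0; have [->|y0 /(_ isT) xy] := eqVneq y 0.
  by rewrite addr0.
have s0 : x + y != 0.
  apply/eqP => /(canRL (addrK _)); rewrite sub0r => xE.
  by move: xy; rewrite xE psiN// ltxx.
have pos u v : u != 0 -> v != 0 -> psi u < psi v -> 0 < u -> 0 < u + v.
  move=> u0 v0 uv up; rewrite og_ltNge; apply/negP => le0.
  have uv' : u <= - v by rewrite -(og_leD2r v) addNr.
  have v0' : - v != 0 by rewrite oppr_eq0.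
  by have := HC Hc u0 v0' up uv'; rewrite psiN// og_leNgt uv.
split => //.
- have := AC1 Hc x0 y0 s0; rewrite minEle (ltW xy) => le1.
  have nx : - y != 0 by rewrite oppr_eq0.
  have := AC1 Hc s0 nx; rewrite addrK psiN// => /(_ x0).
  rewrite minElt; case: ifP => [_ le2|_].
    by apply/le_anti/andP.
  by rewrite og_leNgt xy.
- case: (boolP (0 < x)) => [xp|]; first exact: pos.
  rewrite -og_lt0// => xn; apply/negbTE; rewrite -og_lt0//.
  rewrite -og_oppr_gt0 opprD; apply: pos; rewrite ?oppr_eq0// ?psiN//.
  by rewrite og_oppr_gt0.
Qed.

Lemma psi_add_ge x y : x != 0 -> y != 0 -> x + y != 0 -> psi x <= psi y ->
  psi x <= psi (x + y).
Proof.
by move=> x0 y0 s0 xy; have := AC1 Hc x0 y0 s0; rewrite minEle xy.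
Qed.

Lemma psi_add_gt x y z : x != 0 -> y != 0 -> x + y != 0 ->
  z < psi x -> z < psi y -> z < psi (x + y).
Proof.
move=> x0 y0 s0 zx zy; apply: lt_le_trans (AC1 Hc x0 y0 s0).
by rewrite minEle; case: ifP.
Qed.

Lemma psi_lt_sign x y : x != 0 -> psi x < psi y -> 0 < x -> y < x.
Proof.
move=> x0 xy xp; have dom : dominated x (- y).
  by rewrite /dominated oppr_eq0 => y0; rewrite psiN.
by have [_ _] := dominated_add x0 dom; rewrite og_subr_gt0 xp.
Qed.

Lemma psi_le x y : 0 < x -> x <= y -> psi y <= psi x.
Proof.
move=> xp xy; apply: (HC Hc) => //; rewrite ?gt_eqF//.
exact: lt_le_trans xp xy.
Qed.

(** (AC3) for d = psi y - psi x > 0 says psi y < d + psi d; subtract d. So differences of values are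
    negligible against the elements themselves. *)
Lemma psi_psiB x y : x != 0 -> y != 0 -> psi x < psi y ->
  psi x < psi (psi y - psi x).
Proof.
move=> x0 y0 xy; have d0 : 0 < psi y - psi x by rewrite og_subr_gt0.
have := @AC3 _ _ Hc (psi y - psi x) y; rewrite gt_eqF// => /(_ isT y0 d0).
by rewrite -{1}[psi y](subrKC (psi x)) [psi x + _]addrC og_ltD2l.
Qed.

Definition der x := x + psi x.

(** x' - y' is x - y plus psi x - psi y, and the second summand is negligible: if psi x and psi y
    differ, psi (x - y) is the smaller of them, and [psi_psiB] applies. *)
Lemma der_sub x y : x != 0 -> y != 0 -> x != y ->
  [/\ der x != der y, psi (der x - der y) = psi (x - y) &
      (0 < der x - der y) = (0 < x - y)].
Proof.
move=> x0 y0 xy; have d0 : x - y != 0 by rewrite subr_eq0.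
have E : der x - der y = (x - y) + (psi x - psi y).
  by rewrite /der opprD addrACA.
rewrite -subr_eq0 E; apply: dominated_add => // p0.
have [lt|eq|gt] := og_ltgtP (psi x) (psi y).
- have [_ -> _] : [/\ x - y != 0, psi (x - y) = psi x & (0 < x - y) = (0 < x)].
    by apply: dominated_add => // _; rewrite psiN.
  by rewrite psiB ?psi_psiB// -subr_eq0.
- by rewrite eq subrr eqxx in p0.
- rewrite psiB//.
  have [_ -> _] : [/\ y - x != 0, psi (y - x) = psi y & (0 < y - x) = (0 < y)].
    by apply: dominated_add => // _; rewrite psiN.
  exact: psi_psiB.
Qed.

Lemma der_lt x y : x != 0 -> y != 0 -> (der x < der y) = (x < y).
Proof.
move=> x0 y0; have [->|xy] := eqVneq x y; first by rewrite !ltxx.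
by have [] := der_sub y0 x0; rewrite 1?eq_sym// !og_subr_gt0.
Qed.

Lemma der_inj x y : x != 0 -> y != 0 -> der x = der y -> x = y.
Proof.
move=> x0 y0 E; apply/eqP/negPn/negP => xy.
by have [] := der_sub x0 y0 xy; rewrite E eqxx.
Qed.

End Couple.

Section Triple.
Variables (k : realFieldType) (G : orderedVectType k) (psi : G -> G).
Variable P : set G.
Hypothesis HT : H_triple psi P.
Implicit Types x y z e : G.
Let Hpsi := H_triple_couple HT.
Let HP := H_triple_cut HT.
Let Hc := H_couple_over_couple Hpsi.
Local Notation der := (der psi).

Lemma P_psi x : x != 0 -> P (psi x).
Proof. by move=> x0; apply: (H_cut_Psi HP); exists x. Qed.

Lemma P_down x y : P y -> x <= y -> P x.
Proof. exact: (H_cut_down HP). Qed.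

Lemma P_der x : x != 0 -> P (der x) <-> x < 0.
Proof.
move=> x0; split => [Px|xn].
  rewrite og_lt0//; apply/negP => xp.
  suff : der x < der x by rewrite ltxx.
  by apply: (H_cut_lt HP) => //; exists x.
apply: P_down (P_psi x0) _; apply: ltW.
by rewrite /der -[ltRHS]add0r og_ltD2r.
Qed.

Lemma nP_der x y : 0 < x -> P y -> y < der x.
Proof. by move=> xp Py; apply: (H_cut_lt HP) => //; exists x. Qed.

(** Write x' + e = (x + e) + psi x. If x dominates, psi x = psi (x + e) and [P_der] applies to x +
    e. If e dominates, psi (x + e) < psi x, and x' + e is compared with (x + e)' when x + e > 0, and
    with psi (x + e), by (AC3), when x + e < 0. *)
Lemma P_der_add x e : x != 0 -> (e != 0 -> psi e != psi x) ->
  P (der x + e) <-> x + e < 0.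
Proof.
move=> x0; have [->|e0 /(_ isT) ex] := eqVneq e 0.
  by rewrite !addr0 => _; apply: P_der.
have E : der x + e = (x + e) + psi x by rewrite /der addrAC.
have [lt|eq|gt] := og_ltgtP (psi x) (psi e).
- have [s0 ps sg] := dominated_add Hpsi x0 (fun _ => lt).
  by rewrite E -ps; apply: P_der.
- by rewrite eq eqxx in ex.
- have [s0 ps sg] := dominated_add Hpsi e0 (fun _ => gt).
  rewrite addrC in s0 ps sg; split => [Pd|sn].
    rewrite og_lt0//; apply/negP => sp; have := nP_der sp Pd.
    by rewrite E og_ltD2l ps og_ltNge ltW.
  rewrite E; apply: P_down (P_psi s0) _; apply: ltW.
  have ns0 : - (x + e) != 0 by rewrite oppr_eq0.
  have np : 0 < - (x + e) by rewrite og_oppr_gt0.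
  have := AC3 Hc ns0 x0 np; rewrite psiN// -(og_ltD2l (x + e)).
  by rewrite addNKr.
Qed.

End Triple.

(** * Existential closedness of closed substructures *)

Section GapOverSubspace.
Variables (k : realFieldType) (G : orderedVectType k) (psi : G -> G).
Hypothesis Hpsi : H_couple_over psi.
Local Notation der := (der psi).

(* The integral u of an element of S that has none in S is infinitesimal with
   respect to S. *)
Lemma no_integral_gap (S : set G) (u : G) : subspace S ->
  (forall h, S h -> h != 0 -> S (psi h)) ->
  u != 0 -> S (der u) -> ~ S u -> forall h, S h -> h != 0 -> psi h < psi u.
Proof.
move=> sS Spsi u0 Su nSu h Sh h0.
have nSpu : ~ S (psi u).
  by move=> Spu; apply: nSu; rewrite -(addrK (psi u) u); apply: subspaceB.
have uh : u != h by apply/eqP => E; apply: nSu; rewrite E.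
have [d0 dpsi _] := der_sub Hpsi u0 h0 uh.
(* This is psi (u' - h'), with u' - h' in S. Were psi u < psi h, it would equal psi u, which is not
   in S. *)
have Suh : S (psi (u - h)).
  rewrite -dpsi; apply: (Spsi); last by rewrite subr_eq0.
  by apply: subspaceB => //; apply: subspaceD => //; apply: Spsi.
have [lt|eq|//] := og_ltgtP (psi u) (psi h).
- have [_ E _] := @dominated_add _ _ _ Hpsi u (- h) u0
    (fun _ => eq_ind_r (fun t => psi u < t) lt (psiN Hpsi h0)).
  by case: nSpu; rewrite -E.
- by case: nSpu; rewrite eq; apply: Spsi.
Qed.

End GapOverSubspace.

Lemma seq_argmax (G : orderedZmodType) (T : eqType) (Q : T -> Prop) (f : T -> G)
  (s : seq T) : (exists2 a, a \in s & Q a) ->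
  exists a, [/\ a \in s, Q a & forall b, b \in s -> Q b -> f b <= f a].
Proof.
elim: s => [[]//|t s IH] ext.
case: (pselect (exists2 a, a \in s & Q a)) => [/IH[a [aS Qa amax]]|nex].
  case: (pselect (Q t /\ f a <= f t)) => [[Qt at_]|nt].
    exists t; rewrite mem_head; split => // b; rewrite inE => /orP[/eqP->//|bs] Qb.
    exact: le_trans (amax b bs Qb) at_.
  exists a; rewrite inE aS orbT; split => // b; rewrite inE => /orP[/eqP->|bs] Qb.
    by rewrite og_leNgt; apply/negP => /ltW ?; apply: nt.
  exact: amax.
case: ext => a; rewrite inE => /orP[/eqP->|aS] Qa; last by case: nex; exists a.
exists t; rewrite mem_head; split => // b; rewrite inE => /orP[/eqP->//|bs] Qb.
by case: nex; exists b.
Qed.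

(** * Approximating an element outside A by elements of A *)

Section Approximation.
Variables (k : realFieldType) (G : orderedVectType k) (psi : G -> G).
Variable P : set G.
Hypothesis HT : H_triple psi P.
Let Hpsi := H_triple_couple HT.
Local Notation der := (der psi).
Hypothesis int_ex : forall g : G, exists2 u : G, u != 0 & der u = g.

Variable A : set G.
Hypothesis sA : subspace A.
Hypothesis A_psi : forall a, A a -> a != 0 -> A (psi a).
Hypothesis A_int : forall a, A a -> exists u, [/\ A u, u != 0 & der u = a].
Hypothesis A_Psi : forall a, A a -> P a -> exists u, [/\ A u, u != 0 & psi u = a].

Lemma notin_sub_neq0 x a : ~ A x -> A a -> x - a != 0.
Proof. by move=> nAx Aa; rewrite subr_eq0; apply/eqP => E; apply: nAx; rewrite E. Qed.

(* One step of the chain described above: if x can be moved out of A by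
   psi (x - a), [center x] is such an a and [next_pt x] the resulting value. *)
Definition escapes x := exists a, A a /\ ~ A (psi (x - a)).
Definition center x : G := xget 0 [set a | A a /\ ~ A (psi (x - a))].
Definition next_pt x := psi (x - center x).

Lemma centerP x : escapes x -> A (center x) /\ ~ A (next_pt x).
Proof.
by move=> /(xgetPex 0).
Qed.

Lemma psi_der_gt z u : z != 0 -> u != 0 -> psi z < psi u ->
  psi z != der u -> psi z < psi (psi z - der u).
Proof.
move=> z0 u0 zu d0; have E : psi z - der u = (- u) + (psi z - psi u).
  by rewrite /der opprD addrCA.
have zu0 : psi z - psi u != 0 by rewrite subr_eq0 lt_eqF.
rewrite E; apply: (psi_add_gt Hpsi) => //; rewrite ?oppr_eq0 -?E ?subr_eq0 ?(psiN Hpsi)//.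
by rewrite (psiB Hpsi) ?(psi_psiB Hpsi)// lt_eqF.
Qed.

(** If psi u < [next_pt x], then u dominates [next_pt x - psi u], so psi ([next_pt x] - u') = psi u
    lies in A, contrary to the choice of the second center. *)
Lemma center_next_gt x u : ~ A x -> escapes x -> escapes (next_pt x) -> u != 0 -> A u ->
  der u = center (next_pt x) -> next_pt x < psi u.
Proof.
move=> nAx okx oknx u0 Au uE; have [Ax nAn] := centerP okx.
have [An nAnn] := centerP oknx.
have z0 : x - center x != 0 by apply: notin_sub_neq0.
have [//|eq|lt] := og_ltgtP (next_pt x) (psi u).
  by case: nAn; rewrite eq; apply: A_psi.
case: nAnn; rewrite {1}/next_pt -uE.
have -> : next_pt x - der u = (- u) + (next_pt x - psi u).
  by rewrite /der opprD addrCA.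
have [||_ -> _] := @dominated_add _ _ _ Hpsi (- u) (next_pt x - psi u).
- by rewrite oppr_eq0.
- by move=> _; rewrite (psiN Hpsi)// (psi_psiB Hpsi).
- by rewrite (psiN Hpsi)//; apply: A_psi.
Qed.

(* Integrability of [center (next_pt x)] in A is what makes the chain increase. *)
Lemma next_next_gt x : ~ A x -> escapes x -> escapes (next_pt x) -> next_pt x < next_pt (next_pt x).
Proof.
move=> nAx okx oknx; have [Ax nAn] := centerP okx; have [An nAnn] := centerP oknx.
have [u [Au u0 uE]] := A_int An.
have := center_next_gt nAx okx oknx u0 Au uE => lt.
rewrite {2}/next_pt -uE; apply: psi_der_gt => //; first exact: notin_sub_neq0.
by rewrite uE -subr_eq0; apply: notin_sub_neq0.
Qed.

(** [y != a] is demanded because y will be taken in A, whereas x lies outside A. *)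
Definition same_cut (F : seq G) x y :=
  forall a, a \in F -> A a -> y != a /\ (a < y) = (a < x).

(* Membership in P of b + c x is not controlled by the position of x with respect
   to A exactly when b + c x is not the derivative of an element of A + k x; this
   occurs for at most one pair (b, c), see [no_integral_unique]. *)
Definition gap_cond x y := forall b (c : k), A b ->
  (forall b' (c' : k), A b' -> b' + c' *: x != 0 ->
     der (b' + c' *: x) != b + c *: x) ->
  P (b + c *: y) <-> P (b + c *: x).

(* y imitates the first m steps of the chain of x, relative to the finite set F *)
Fixpoint approx_cond m F x y : Prop :=
  [/\ same_cut F x y,
   (escapes x -> if m is m'.+1 then approx_cond m' F (next_pt x) (psi (y - center x)) else True) &
   (~ escapes x -> (forall a, a \in F -> A a -> psi (y - a) = psi (x - a)) /\
              gap_cond x y)].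

Lemma approx_cond_mono m m' F F' x y : (m <= m')%N -> {subset F <= F'} ->
  approx_cond m' F' x y -> approx_cond m F x y.
Proof.
move=> + sF; elim: m' m x y => [|m' IH] [|m] x y //= mm [sg c1 c2]; split => //.
all: try by move=> a /sF; apply: sg.
all: try by move=> /c2[h1 h2]; split => // a /sF; apply: h1.
by move=> /c1; apply: IH.
Qed.

(** The sets of y in A with [approx_cond m F x y] form a filter base, the neighbourhoods of x in A;
    [ev x S] says that S holds on one of them. By [approx] none of them is empty when x is outside
    A. *)
Definition ev x (S : G -> Prop) :=
  exists m F, forall y, A y -> approx_cond m F x y -> S y.

Lemma ev_and x S1 S2 : ev x S1 -> ev x S2 -> ev x (fun y => S1 y /\ S2 y).
Proof.
move=> [m1 [F1 h1]] [m2 [F2 h2]]; exists (maxn m1 m2), (F1 ++ F2) => y Ay Cy.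
split; [apply: h1 => // | apply: h2 => //]; apply: approx_cond_mono Cy.
- exact: leq_maxl.
- by move=> a; rewrite mem_cat => ->.
- exact: leq_maxr.
- by move=> a; rewrite mem_cat orbC => ->.
Qed.

Lemma ev_mono x (S1 S2 : G -> Prop) : (forall y, A y -> S1 y -> S2 y) ->
  ev x S1 -> ev x S2.
Proof. by move=> h [m [F hF]]; exists m, F => y Ay Cy; apply/h/hF. Qed.

Lemma ev_all x (S : G -> Prop) : (forall y, S y) -> ev x S.
Proof. by move=> h; exists 0%N, [::]. Qed.

Lemma ev_sign x a : A a -> ev x (fun y => y != a /\ (a < y) = (a < x)).
Proof.
by move=> Aa; exists 0%N, [:: a] => y Ay [sg _ _]; apply: sg; rewrite ?mem_head.
Qed.

Lemma ev_end x a : ~ escapes x -> A a -> ev x (fun y => psi (y - a) = psi (x - a)).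
Proof.
move=> nok Aa; exists 0%N, [:: a] => y Ay [_ _ /(_ nok)[h _]].
by apply: h; rewrite ?mem_head.
Qed.

Lemma ev_gap x : ~ escapes x -> ev x (gap_cond x).
Proof. by move=> nok; exists 0%N, [::] => y Ay [_ _ /(_ nok)[]]. Qed.

Lemma ev_next x S : escapes x -> ev (next_pt x) S -> ev x (fun y => S (psi (y - center x))).
(* The center joins F so that y differs from it; then psi (y - [center x]) lies in A, as a
   neighbourhood of [next_pt x] requires. *)
Proof.
move=> okx [m [F h]]; exists m.+1, (center x :: F) => y Ay [sg c1 _].
have [Ap _] := centerP okx; apply: h.
  apply: A_psi; first exact: subspaceB.
  by rewrite subr_eq0; have [] := sg _ (mem_head _ _) Ap.
apply: approx_cond_mono (c1 okx) => //.
by move=> a aF; rewrite inE aF orbT.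
Qed.

(** The integral u in A of the second center has psi u > [next_pt x]. Since psi u is in A, the cut
    condition transfers this bound to psi (y - [center x]), and [psi_der_gt] applies. *)
Lemma ev_next_next_gt x : ~ A x -> escapes x -> escapes (next_pt x) ->
  ev x (fun y => psi (y - center x) < psi (psi (y - center x) - center (next_pt x))).
Proof.
move=> nAx okx oknx; have [Ap _] := centerP okx; have [An _] := centerP oknx.
have [u [Au u0 uE]] := A_int An; have Apu := A_psi Au u0.
have lt := center_next_gt nAx okx oknx u0 Au uE.
apply: ev_mono (ev_and (ev_sign x Ap) (ev_next okx (ev_and (ev_sign (next_pt x) Apu)
  (ev_sign (next_pt x) An)))) => y Ay [[yp _] [[yu su] [yn _]]].
rewrite -uE in yn *; apply: psi_der_gt => //; first by rewrite subr_eq0.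
by rewrite og_ltNge le_eqVlt negb_or eq_sym yu su -og_leNgt ltW.
Qed.

(* The functions y |-> b + sum_i c_i (y_i - a_i) along the chain of x; every
   L_k-term agrees with one of them near x, cf. [ev_term]. *)
Inductive Span : G -> (G -> G) -> Prop :=
| Span_const x b f : A b -> (forall y, f y = b) -> Span x f
| Span_end x b (c : k) f : ~ escapes x -> A b -> (forall y, f y = b + c *: y) ->
    Span x f
| Span_step x (c : k) g f : escapes x -> Span (next_pt x) g ->
    (forall y, f y = c *: (y - center x) + g (psi (y - center x))) -> Span x f.

Lemma Span_ext x f g : (forall y, g y = f y) -> Span x f -> Span x g.
Proof.
move=> E Sf; case: Sf g E => {x f}.
- by move=> x b f Ab h g E; apply: (@Span_const x b) => // y; rewrite E.
- by move=> x b c f nok Ab h g E; apply: (@Span_end x b c) => // y; rewrite E.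
- by move=> x c g' f okx sg h g E; apply: (@Span_step x c g') => // y; rewrite E.
Qed.

Lemma Span_addc x f b : A b -> Span x f -> Span x (fun y => b + f y).
Proof.
move=> Ab; elim=> {x f}.
- move=> x b' f Ab' h; apply: (@Span_const x (b + b')); first exact: subspaceD.
  by move=> y; rewrite h.
- move=> x b' c f nok Ab' h; apply: (@Span_end x (b + b') c) => //.
    exact: subspaceD.
  by move=> y; rewrite h addrA.
- move=> x c g f okx _ IH h; apply: (@Span_step x c (fun y => b + g y)) => //.
  by move=> y; rewrite h addrCA.
Qed.

Lemma Span_scale x f (d : k) : Span x f -> Span x (fun y => d *: f y).
Proof.
elim=> {x f}.
- move=> x b' f Ab' h; apply: (@Span_const x (d *: b')); first exact: subspaceZ.
  by move=> y; rewrite h.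
- move=> x b' c f nok Ab' h; apply: (@Span_end x (d *: b') (d * c)) => //.
    exact: subspaceZ.
  by move=> y; rewrite h scalerDr scalerA.
- move=> x c g f okx _ IH h; apply: (@Span_step x (d * c) (fun y => d *: g y)) => //.
  by move=> y; rewrite h scalerDr scalerA.
Qed.

Lemma Span_add x f g : Span x f -> Span x g -> Span x (fun y => f y + g y).
Proof.
move=> Sf; elim: Sf g => {x f}.
- move=> x b f Ab h g Sg; apply: Span_ext (Span_addc Ab Sg) => y.
  by rewrite h.
- move=> x b c f nok Ab h g Sg.
  have Sf : Span x f by apply: (@Span_end x b c).
  case: Sg nok Sf h => {x g}.
  + move=> x b' g Ab' h' nok Sf h; apply: Span_ext (Span_addc Ab' Sf) => y.
    by rewrite h' addrC.
  + move=> x b' c' g _ Ab' h' nok Sf h.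
    apply: (@Span_end x (b + b') (c + c')) => //; first exact: subspaceD.
    by move=> y; rewrite h h' scalerDl addrACA.
  + by move=> x c' g' g okx.
- move=> x c f' f okx Sf' IH h g Sg.
  have Sf : Span x f by apply: (@Span_step x c f').
  case: Sg okx Sf' Sf IH h => {x g}.
  + move=> x b' g Ab' h' okx _ Sf IH h; apply: Span_ext (Span_addc Ab' Sf) => y.
    by rewrite h' addrC.
  + by move=> x b' c' g nok.
  + move=> x c' g' g okx Sg' h' _ Sf' Sf IH h.
    apply: (@Span_step x (c + c') (fun y => f' y + g' y)) => //; first exact: IH.
    by move=> y; rewrite h h' scalerDl addrACA.
Qed.

Lemma Span_id x : Span x id.
Proof.
case: (pselect (escapes x)) => okx.
  have [Ap _] := centerP okx.
  apply: (@Span_step x 1 (fun=> center x)) => //; first exact: (@Span_const _ (center x)).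
  by move=> y; rewrite scale1r subrK.
apply: (@Span_end x 0 1) => //; first exact: subspace0.
by move=> y; rewrite add0r scale1r.
Qed.

Lemma Span_cst x b : A b -> Span x (fun=> b).
Proof. by move=> Ab; apply: (@Span_const x b). Qed.

Lemma Span_next x g : escapes x -> Span (next_pt x) g ->
  Span x (fun y => g (psi (y - center x))).
Proof.
by move=> okx Sg; apply: (@Span_step x 0 g) => // y; rewrite scale0r add0r.
Qed.

(** Near x, psi of f is a constant of A or again a function of the span, with a value outside A and
    at least [next_pt x]. The lower bounds serve the induction in [germ]: one step earlier in the
    chain they make f negligible against the leading term. *)
Definition tame x f :=
  [/\ f x != 0, ev x (fun y => f y != 0 /\ (0 < f y) = (0 < f x)) &
  (A (psi (f x)) /\ ev x (fun y => psi (f y) = psi (f x))) \/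
  [/\ escapes x, ~ A (psi (f x)), next_pt x <= psi (f x),
    exists2 h, Span x h & h x = psi (f x) /\ ev x (fun y => psi (f y) = h y) &
    ev x (fun y => psi (y - center x) <= psi (f y))]].

Lemma tame_const x b f : A b -> (forall y, f y = b) -> b != 0 -> tame x f.
Proof.
move=> Ab h b0; split; first by rewrite h.
  by apply: ev_all => y; rewrite !h.
left; rewrite h; split; first exact: A_psi.
by apply: ev_all => y; rewrite h.
Qed.

Lemma next_notin x b : escapes x -> A b -> next_pt x != b.
Proof. by move=> /centerP[_ nAn] Ab; apply/eqP => E; apply: nAn; rewrite E. Qed.

(** Induction along the chain. If c is nonzero, the leading term c (y - [center x]) has at x the
    value [next_pt x]. The value of the tail lies in A, hence differs from [next_pt x], or it is at
    least the next link of the chain, hence larger. Either way one summand dominates, at x and at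
    all y near x. *)
Lemma germ x f : Span x f -> ~ A x -> (forall y, f y = 0) \/ tame x f.
Proof.
elim=> {x f}.
- move=> x b f Ab h _; have [b0|b0] := eqVneq b 0; [left|right].
    by move=> y; rewrite h.
  exact: (@tame_const _ b).
- move=> x b c f nok Ab h nAx; have [c0|c0] := eqVneq c 0.
    have {}h y : f y = b by rewrite h c0 scale0r addr0.
    have [b0|b0] := eqVneq b 0; [left|right].
      by move=> y; rewrite h.
    exact: (@tame_const _ b).
  right; pose a := - (c^-1 *: b).
  have Aa : A a by apply: (subspaceN sA); apply: (subspaceZ sA).
  have E y : f y = c *: (y - a).
    by rewrite h /a opprK scalerDr scalerA divff// scale1r addrC.
  have z0 : x - a != 0 by apply: notin_sub_neq0.
  split; first by rewrite E ov_scale_neq0.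
    apply: ev_mono (ev_sign x Aa) => y Ay [ya yx]; rewrite !E.
    have y0 : y - a != 0 by rewrite subr_eq0.
    by split; [exact: ov_scale_neq0 | rewrite !ov_scale_gt0// !og_subr_gt0 yx].
  left; rewrite E (psiZ Hpsi)//; split.
    by apply: contrapT => nA; apply: nok; exists a.
  apply: ev_mono (ev_and (ev_sign x Aa) (ev_end nok Aa)) => y Ay [[ya _] <-].
  by rewrite E (psiZ Hpsi)// subr_eq0.
- move=> x c g f okx Sg IH h nAx.
  have [Ap nAn] := centerP okx.
  have {IH} := IH nAn.
  have z0 : x - center x != 0 by apply: notin_sub_neq0.
  have zev := ev_sign x Ap.
  have [c0|c0] := eqVneq c 0.
    have {}h y : f y = g (psi (y - center x)) by rewrite h c0 scale0r add0r.
    case=> [g0|[gx gs galt]]; [left|right].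
      by move=> y; rewrite h g0.
    split; first by rewrite h.
      apply: ev_mono (ev_next okx gs) => y Ay; rewrite !h => -[? ?].
      by split.
    case: galt => [[Ag eg]|[oknx nAg ng [h' Sh' [h'x h'e]] ge]]; [left|right].
      rewrite h; split => //.
      by apply: ev_mono (ev_next okx eg) => y Ay; rewrite h.
    split => //; rewrite ?h//.
    + exact: le_trans (ltW (next_next_gt nAx okx oknx)) ng.
    + exists (fun y => h' (psi (y - center x))); first exact: Span_next.
      by split => //; apply: ev_mono (ev_next okx h'e) => y Ay; rewrite h.
    + apply: ev_mono (ev_and (ev_next_next_gt nAx okx oknx) (ev_next okx ge)) => y Ay.
      by move=> [lt le]; rewrite h; apply: le_trans le; apply: ltW.
  move=> galt; right.
  have cz0 : c *: (x - center x) != 0 by exact: ov_scale_neq0.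
  have dom : dominated psi (c *: (x - center x)) (g (next_pt x)) ->
    ev x (fun y => dominated psi (y - center x) (g (psi (y - center x)))) -> tame x f.
    move=> d0 d1; have [f0 fp fs] := dominated_add Hpsi cz0 d0.
    have fev : ev x (fun y => [/\ f y != 0, psi (f y) = psi (y - center x) &
                       (0 < f y) = (0 < f x)]).
      apply: ev_mono (ev_and zev d1) => y Ay [[yp sy] d].
      have yp0 : y - center x != 0 by rewrite subr_eq0.
      have [||f0' fp' fs'] := @dominated_add _ _ _ Hpsi (c *: (y - center x))
        (g (psi (y - center x))).
      - exact: ov_scale_neq0.
      - by rewrite /dominated (psiZ Hpsi).
      - rewrite !h; split => //; first by rewrite fp' (psiZ Hpsi).
        rewrite fs' -/(next_pt x) fs !ov_scale_gt0// !og_subr_gt0 sy//.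
    rewrite (psiZ Hpsi)// -/(next_pt x) in fp.
    split; first by rewrite h.
      by apply: ev_mono fev => y Ay [].
    right; rewrite h -/(next_pt x) fp; split => //.
    + exists (fun y => psi (y - center x)); first by apply: (Span_next okx (Span_id _)).
      by split => //; apply: ev_mono fev => y Ay [].
    + by apply: ev_mono fev => y Ay [_ -> _].
  case: galt => [g0|[gx gs [[Ag eg]|[oknx nAg ng _ ge]]]].
  + apply: dom; rewrite /dominated ?g0 ?eqxx//.
    by apply: ev_all => y; rewrite g0 eqxx.
  + have := next_notin okx Ag.
    have ebs := ev_next okx (ev_and gs (ev_and eg (ev_sign (next_pt x) Ag))).
    (* Treated first is the case where the tail dominates: its value is a constant of A, so f falls
       under the first alternative of [tame]. *)
    have [lt _|eq|lt _] := og_ltgtP (next_pt x) (psi (g (next_pt x))); last 1 first.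
    * have [|f0 fp fs] := @dominated_add _ _ _ Hpsi (g (next_pt x)) (c *: (x - center x)) gx.
        by rewrite /dominated (psiZ Hpsi).
      have fev : ev x (fun y => [/\ f y != 0, psi (f y) = psi (g (next_pt x)) &
                       (0 < f y) = (0 < f x)]).
        apply: ev_mono (ev_and zev ebs) => y Ay [[yp sy] [[g0y gsy] [gp [y1 y1s]]]].
        have yp0 : y - center x != 0 by rewrite subr_eq0.
        have [||f0' fp' fs'] := @dominated_add _ _ _ Hpsi (g (psi (y - center x)))
          (c *: (y - center x)) => //.
          by rewrite /dominated (psiZ Hpsi)// gp y1s lt.
        rewrite !h addrC; split => //; first by rewrite fp' gp.
        by rewrite fs' [c *: (x - _) + _]addrC fs gsy.
      rewrite addrC in f0 fp fs.
      split; first by rewrite h.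
        by apply: ev_mono fev => y Ay [].
      left; rewrite h -/(next_pt x) fp; split => //.
      by apply: ev_mono fev => y Ay [].
    * apply: dom; first by rewrite /dominated (psiZ Hpsi).
      apply: ev_mono (ebs) => y Ay [[g0y gsy] [gp [y1 y1s]]] _.
      rewrite gp og_ltNge le_eqVlt negb_or eq_sym y1 y1s.
      by rewrite -og_leNgt ltW.
    * by rewrite -eq eqxx.
  + have lt := next_next_gt nAx okx oknx.
    apply: dom; first by rewrite /dominated (psiZ Hpsi)// => _; apply: lt_le_trans ng.
    apply: ev_mono (ev_and (ev_next_next_gt nAx okx oknx) (ev_next okx ge)) => y Ay.
    by move=> [lt' le] _; apply: lt_le_trans le.
Qed.

Lemma Span_eq0 x f : Span x f -> ~ A x -> f x = 0 -> forall y, f y = 0.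
Proof. by move=> Sf nAx fx0; case: (germ Sf nAx) => [|[]]//; rewrite fx0 eqxx. Qed.

Lemma Span_sub x f g : Span x f -> Span x g -> Span x (fun y => f y - g y).
Proof.
move=> Sf Sg; apply: Span_ext (Span_add Sf (Span_scale (-1) Sg)) => y.
by rewrite scaleN1r.
Qed.

Lemma Span_psi x f : Span x f -> ~ A x -> f x != 0 ->
  exists2 h, Span x h & h x = psi (f x) /\ ev x (fun y => psi (f y) = h y).
Proof.
move=> Sf nAx fx0; case: (germ Sf nAx) => [f0|[_ _ [[Ap e]|[]//]]].
  by rewrite f0 eqxx in fx0.
by exists (fun=> psi (f x)) => //; apply: Span_cst.
Qed.

(** * Membership in [P] near x *)

Definition value x : set G := [set u | exists2 f, Span x f & f x = u].

Lemma value_subspace x : subspace (value x).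
Proof.
split.
- by exists (fun=> 0) => //; apply/Span_cst/(subspace0 sA).
- move=> _ _ [f Sf <-] [g Sg <-]; exists (fun y => f y + g y) => //.
  exact: Span_add.
- move=> c _ [f Sf <-]; exists (fun y => c *: f y) => //.
  exact: Span_scale.
Qed.

(** So [value x] is the group part of the substructure generated by A and x, and [no_integral_gap]
    is available for it. *)
Lemma value_psi x : ~ A x -> forall h, value x h -> h != 0 -> value x (psi h).
Proof.
by move=> nAx _ [f Sf <-] f0; have [h Sh [hx _]] := Span_psi Sf nAx f0; exists h.
Qed.

Definition no_integral x f :=
  forall h, Span x h -> h x != 0 -> der (h x) != f x.

Lemma no_integral_value x f : no_integral x f -> forall u, u != 0 -> der u = f x -> ~ value x u.
Proof.
by move=> bf u u0 uE [h Sh hx]; have := bf _ Sh; rewrite hx uE eqxx => /(_ u0).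
Qed.

(** A leading coefficient c != 0 is impossible: let z = x - [center x] and let u be the integral of
    f x, infinitesimal over [value x]. Then psi (u' - (c z)') = psi (c z) = [next_pt x]; but u' - (c
    z)' is g ([next_pt x]) - [next_pt x], whose value by [germ] is in A or beyond [next_pt x]. So f
    factors through the next link. At the end of the chain [gap_cond] is what is asked, and
    constants have integrals in A. *)
Lemma ev_P_no_integral x f : Span x f -> ~ A x -> no_integral x f ->
  ev x (fun y => P (f y) <-> P (f x)).
Proof.
elim=> {x f}.
- move=> x b f Ab h _ bf; have [u [Au u0 uE]] := A_int Ab.
  by have /(_ u0) := bf _ (Span_cst x Au); rewrite h uE eqxx.
- move=> x b c f nok Ab h nAx bf.
  apply: ev_mono (ev_gap nok) => y Ay gc; rewrite !h; apply: gc => //.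
  move=> b' c' Ab' h0; rewrite -h.
  by apply: (bf (fun y => b' + c' *: y)) => //; apply: (@Span_end x b' c').
- move=> x c g f okx Sg IH h nAx bf.
  have [Ap nAn] := centerP okx.
  have z0 : x - center x != 0 by apply: notin_sub_neq0.
  have Sf : Span x f by apply: (@Span_step x c g).
  have c0 : c = 0.
    apply/eqP/negPn/negP => c0; have [u u0 uE] := int_ex (f x).
    have nvu := no_integral_value bf u0 uE.
    have cz0 : c *: (x - center x) != 0 by exact: ov_scale_neq0.
    have vcz : value x (c *: (x - center x)).
      exists (fun y => c *: (y - center x)) => //.
      by apply/Span_scale/Span_sub; [exact: Span_id | exact: Span_cst].
    have vdu : value x (der u) by rewrite uE; exists f.
    have lt := no_integral_gap Hpsi (value_subspace x) (value_psi nAx) u0 vdu nvu vcz cz0.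
    have ucz : u != c *: (x - center x) by apply/eqP => E; apply: nvu; rewrite E.
    have [d0 dpsi _] := der_sub Hpsi u0 cz0 ucz.
    have E : der u - der (c *: (x - center x)) = g (next_pt x) - next_pt x.
      by rewrite uE h /der (psiZ Hpsi)// opprD addrACA subrr add0r.
    have psE : psi (g (next_pt x) - next_pt x) = next_pt x.
      rewrite -E dpsi (psiB Hpsi)//.
      have [||_ -> _] := @dominated_add _ _ _ Hpsi (c *: (x - center x)) (- u) => //.
      - by move=> _; rewrite (psiN Hpsi).
      - by rewrite (psiZ Hpsi).
    have := germ (Span_sub Sg (Span_id (next_pt x))) nAn.
    case=> [g0|[_ _ [[] | [oknx nA le _ _]]]].
    + by move: d0; rewrite -subr_eq0 E g0 eqxx.
    + by rewrite psE.
    + by move: le; rewrite psE og_leNgt next_next_gt.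
  have {}h y : f y = g (psi (y - center x)) by rewrite h c0 scale0r add0r.
  have bg : no_integral (next_pt x) g.
    move=> h' Sh' h'0; rewrite -[X in _ != X]/(g (psi (x - center x))) -h.
    exact: (bf _ (Span_next okx Sh')).
  by apply: ev_mono (ev_next okx (IH nAn bg)) => y Ay; rewrite !h.
Qed.

(** If f x = (h x)' with h in the span, then f = h + psi h near x, since span functions that agree
    at x are equal; [P] is then read off the sign of h, which is constant near x. *)
Lemma ev_P x f : Span x f -> ~ A x -> ev x (fun y => P (f y) <-> P (f x)).
Proof.
move=> Sf nAx; case: (pselect (no_integral x f)) => [|nbf]; first exact: ev_P_no_integral.
have [h [Sh h0 hE]] : exists h, [/\ Span x h, h x != 0 & der (h x) = f x].
  apply: contrapT => nex; apply: nbf => h Sh h0.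
  by apply/eqP => E; apply: nex; exists h.
have [m Sm [mx me]] := Span_psi Sh nAx h0.
have d0 := Span_eq0 (Span_sub (Span_add Sh Sm) Sf) nAx.
have {}d0 y : h y + m y = f y.
  by apply/eqP; rewrite -subr_eq0 d0// mx -hE subrr.
case: (germ Sh nAx) => [hz|[_ hs _]]; first by rewrite hz eqxx in h0.
apply: ev_mono (ev_and me hs) => y Ay [pm [hy0 hs']].
rewrite -hE -d0 -pm; have [Px Px'] := P_der HT h0; have [Py Py'] := P_der HT hy0.
split; first by move/Py; rewrite og_lt0// hs' -og_lt0//.
by move/Px; rewrite og_lt0// -hs' -og_lt0//.
Qed.

(** Some b in A lies strictly between 0 and the integral u of x. So b' lies between the cut [P] and
    x, and a y on the same side of b' as x is on the same side of [P]. *)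
Lemma escapes_P_cut x : ~ A x -> escapes x ->
  exists F, forall y, same_cut F x y -> (P y <-> P x).
Proof.
move=> nAx okx; have [u u0 uE] := int_ex x; have [Ap nAn] := centerP okx.
have [a [Aa a0 aE]] := A_int Ap.
have ua : u != a by apply/eqP => E; apply: nAx; rewrite -uE E aE.
have [d0 dpsi _] := der_sub Hpsi u0 a0 ua.
rewrite uE aE -/(next_pt x) in dpsi.
(* Half of the integral a of the center, up to sign: it is negligible against u if psi u < psi a,
   while psi u = psi a makes u - a negligible. And psi a < psi u would give [next_pt x] = psi a in
   A. *)
have [b [Ab b0 bu ub]] : exists b, [/\ A b, b != 0, (0 < b) = (0 < u) &
    (0 < u - b) = (0 < u)].
  have Ah : A (ov_half a) by exact: subspaceZ.
  have h2 : 2^-1 != 0 :> k by rewrite invr_eq0 pnatr_eq0.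
  have h0 : ov_half a != 0 by exact: ov_scale_neq0.
  have hp : psi (ov_half a) = psi a by exact: psiZ Hpsi _ _ h2 a0.
  have [lt|eq|gt] := og_ltgtP (psi u) (psi a).
  - pose b := if (0 < ov_half a) == (0 < u) then ov_half a else - ov_half a.
    have b0 : b != 0 by rewrite /b; case: ifP => // _; rewrite oppr_eq0.
    have bp : psi b = psi a.
      by rewrite /b; case: ifP => // _; rewrite (psiN Hpsi).
    exists b; split => //.
    + by rewrite /b; case: ifP => // _; apply: subspaceN.
    + rewrite /b; case: ifP => [/eqP//|]; rewrite og_gt0N//.
      by case: (0 < ov_half a); case: (0 < u).
    + have [||_ _ //] := @dominated_add _ _ _ Hpsi u (- b) => //.
      by move=> _; rewrite (psiN Hpsi)// bp.
  - have uma0 : u - a != 0 by rewrite subr_eq0.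
    have lt : psi a < psi (u - a).
      rewrite lt_neqAle; apply/andP; split.
        by apply/eqP => E; apply: nAn; rewrite dpsi -E; apply: A_psi.
      rewrite -{1}eq; apply: (psi_add_ge Hpsi) => //; rewrite ?oppr_eq0//.
      by rewrite (psiN Hpsi)// eq.
    have [_ _ s1] := dominated_add Hpsi a0 (fun _ => lt).
    have [||_ _ s2] := @dominated_add _ _ _ Hpsi (ov_half a) (u - a) => //.
      by move=> _; rewrite hp.
    rewrite subrKC ov_half_gt0 in s1 s2 *.
    exists (ov_half a); split; rewrite ?ov_half_gt0 ?s1//.
    have -> : u - ov_half a = ov_half a + (u - a).
      by rewrite -{3}(ov_halfD a) opprD addrCA addNKr.
    by rewrite s2.
  - have [||_ E _] := @dominated_add _ _ _ Hpsi (- a) u.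
    + by rewrite oppr_eq0.
    + by move=> _; rewrite (psiN Hpsi).
    + case: nAn; rewrite dpsi addrC E (psiN Hpsi)//; exact: A_psi.
exists [:: der b] => y /(_ _ (mem_head _ _))[].
  by apply: subspaceD => //; apply: A_psi.
rewrite -uE => yb sy.
have nub : u != b by apply/eqP => E; apply: nAx; rewrite -uE E; apply: subspaceD => //; apply: A_psi.
rewrite (der_lt Hpsi)// in sy.
have Eub : (b < u) = (0 < u) by rewrite -ub og_subr_gt0.
case: (boolP (0 < u)) => [up|un].
  have nPb : ~ P (der b) by move/(P_der HT b0); rewrite og_lt0// bu up.
  rewrite Eub up in sy.
  split => [Py|/(P_der HT u0)]; last by rewrite og_lt0// up.
  by case: nPb; apply: (P_down HT) Py (ltW sy).
have Pb : P (der b) by apply/(P_der HT b0); rewrite og_lt0// bu.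
split=> _; first by apply/(P_der HT u0); rewrite og_lt0.
apply: (P_down HT) Pb _; rewrite og_leNgt sy Eub //.
Qed.

(** F must work for every m, because [approx] uses it at the depth m of its induction. *)
Lemma approx_cond_P x : ~ A x ->
  exists F, forall m y, A y -> approx_cond m F x y -> (P y <-> P x).
Proof.
move=> nAx; case: (pselect (escapes x)) => okx.
  have [F hF] := escapes_P_cut nAx okx; exists F => -[|m] y Ay [sg _ _]; exact: hF.
have [m [F hF]] := ev_P (Span_id x) nAx; exists F => m' y Ay Cy.
by apply: hF => //; case: m' m Cy => [|m'] [|m] [].
Qed.

(** * Existence of approximations *)

Lemma A_pos a : A a -> P a -> exists D, [/\ A D, 0 < D & psi D = a].
Proof.
move=> Aa Pa; have [u [Au u0 uE]] := A_Psi Aa Pa.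
case: (boolP (0 < u)) => up; first by exists u.
exists (- u); split; [exact: subspaceN | by rewrite og_gt0N | by rewrite (psiN Hpsi)].
Qed.

(** y is the midpoint of the gap of F around x, or at distance D outside F if x is beyond all of F.
    In each case e is the distance of y to some element of F and a lower bound for its distance to
    the others. *)
Lemma bracket x (F : seq G) D : ~ A x -> A D -> 0 < D -> (exists2 a, a \in F & A a) ->
  exists y e, [/\ A y, 0 < e,
    e = D \/ (exists l r, [/\ l \in F, A l, r \in F & A r] /\
                [/\ l < x, x < r & e = ov_half (r - l)]),
    exists l, [/\ l \in F, A l & y - l = e \/ l - y = e] &
    forall a, a \in F -> A a ->
      (a < x -> e <= y - a) /\ (x < a -> e <= a - y)].
Proof.
move=> nAx AD D0 [a0 a0F Aa0].
have nx0 a : A a -> x < a \/ a < x.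
  by move=> Aa; case: (og_ltgtP x a) => [|E|]; [left|case: nAx; rewrite E|right].
have subl (a b c : G) : a <= b -> c - b <= c - a.
  by move=> ab; rewrite og_leD2l -(og_leD2r b) addNr addrC og_subr_ge0.
have subr (a b c : G) : a <= b -> a - c <= b - c by rewrite og_leD2r.
case: (pselect (exists2 a, a \in F & A a /\ a < x)) => exl.
  have [l [lF [Al lx] lmax]] := seq_argmax id exl.
  case: (pselect (exists2 a, a \in F & A a /\ x < a)) => exr.
    have [r [rF [Ar xr] rmin]] := seq_argmax -%R exr.
    have yl : ov_half (l + r) - l = ov_half (r - l).
      rewrite -{2}(ov_halfD l) opprD addrA /ov_half scalerDr scalerBr.
      by rewrite [_ + _ *: r]addrC addrK.
    have ry : r - ov_half (l + r) = ov_half (r - l).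
      rewrite -{1}(ov_halfD r) /ov_half scalerDr scalerBr opprD addrACA subrr.
      by rewrite addr0 addrC.
    have Ay : A (ov_half (l + r)) by apply: (subspaceZ sA); apply: subspaceD.
    exists (ov_half (l + r)), (ov_half (r - l)); split => //.
    - by rewrite ov_half_gt0 og_subr_gt0 (lt_trans lx).
    - by right; exists l, r.
    - by exists l; split => //; left.
    - move=> a aF Aa; split => ax.
        by rewrite -yl; apply/subl/lmax.
      rewrite -ry; apply: subr; have := rmin _ aF (conj Aa ax).
      by move/(ler_translate _ _ a)/(ler_translate _ _ r); rewrite subrr addr0 addrCA subrr addr0.
  exists (l + D), D; split => //.
  - exact: subspaceD.
  - by left.
  - by exists l; split => //; left; rewrite [l + D]addrC addrK.
  - move=> a aF Aa; split => ax; last by case: exr; exists a.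
    by rewrite -{1}(addrK l D) [D + l]addrC; apply/subl/lmax.
have [l [lF [Al xl] lmin]] : exists a, [/\ a \in F, (A a /\ x < a) &
    forall b, b \in F -> A b /\ x < b -> - b <= - a].
  apply: (seq_argmax -%R); exists a0 => //; split => //.
  by case: (nx0 _ Aa0) => // a0x; case: exl; exists a0.
exists (l - D), D; split => //.
- exact: subspaceB.
- by left.
- by exists l; split => //; right; rewrite subKr.
- move=> a aF Aa; split => ax; first by case: exl; exists a.
  rewrite -{1}(subKr l D); apply: subr; have := lmin _ aF (conj Aa ax).
  by move/(ler_translate _ _ a)/(ler_translate _ _ l); rewrite subrr addr0 addrCA subrr addr0.
Qed.

(** Let c be the largest psi (x - a), and F' the set of a that attain it. Elements of F' differ by
    values at least c, so a y that [bracket] places at a distance of value c has psi (y - a) = c for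
    a in F'. For the other a, both x - a and y - a differ negligibly from a0 - a, where a0 is in
    F'. *)
Lemma approx_psi x (F : seq G) : ~ A x -> ~ escapes x -> exists2 y, A y &
  forall a, a \in F -> A a ->
    [/\ y != a, (a < y) = (a < x) & psi (y - a) = psi (x - a)].
Proof.
move=> nAx nok.
have Apsi a : A a -> A (psi (x - a)).
  by move=> Aa; apply: contrapT => nA; apply: nok; exists a.
have A0 : A 0 := subspace0 sA.
have ex0 : exists2 a, a \in 0 :: F & A a by exists 0; rewrite ?mem_head.
have [a0 [a0F Aa0 a0max]] := seq_argmax (fun a => psi (x - a)) ex0.
have xa0 a : A a -> x - a != 0 by move=> Aa; apply: notin_sub_neq0.
set c := psi (x - a0) in a0max.
have [D [AD D0 Dc]] : exists D, [/\ A D, 0 < D & psi D = c].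
  by apply: A_pos; [exact: Apsi | apply: (P_psi HT); apply: xa0].
pose F' := [seq a <- 0 :: F | psi (x - a) == c].
have memF' a : a \in F' -> psi (x - a) = c by rewrite mem_filter => /andP[/eqP].
have ex1 : exists2 a, a \in F' & A a.
  by exists a0 => //; rewrite mem_filter eqxx.
have [y [e [Ay e0 eD [l [lF Al yl]] ya]]] := bracket nAx AD D0 ex1.
have psi2 a b : a \in F' -> b \in F' -> A a -> A b -> a != b -> c <= psi (b - a).
  move=> aF bF Aa Ab ab.
  have E : b - a = (x - a) + - (x - b) by rewrite opprB [RHS]addrC addrA subrK.
  rewrite E -(memF' _ aF); apply: (psi_add_ge Hpsi).
  - exact: xa0.
  - by rewrite oppr_eq0 xa0.
  - by rewrite -E subr_eq0 eq_sym.
  - by rewrite (psiN Hpsi) ?xa0// (memF' _ aF) (memF' _ bF).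
(* For a gap (l', r) around x, 0 < x - l' < r - l' bounds the value by c from above, and [psi2]
   bounds it from below. *)
have pe : psi e = c.
  case: eD => [->//|[l' [r [[l'F Al' rF Ar] [l'x xr ->]]]]].
  have rl : l' < r by apply: lt_trans xr.
  have rl0 : r - l' != 0 by rewrite subr_eq0 gt_eqF.
  have h2 : 2^-1 != 0 :> k by rewrite invr_eq0 pnatr_eq0.
  rewrite /ov_half (psiZ Hpsi h2 rl0); apply/le_anti/andP; split.
    rewrite -(memF' _ l'F); apply: (psi_le Hpsi); rewrite ?og_subr_gt0//.
    by rewrite og_leD2r ltW.
  by apply: psi2 => //; rewrite lt_eqF.
have yF' a : a \in F' -> A a ->
    [/\ y != a, (a < y) = (a < x) & psi (y - a) = c].
  move=> aF Aa; have [h1 h2] := ya _ aF Aa.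
  have [yna sgn le] : [/\ y != a, (a < y) = (a < x) & psi (y - a) <= c].
    case: (og_ltgtP a x) => [ax|E|xa]; last 2 first.
    - by case: nAx; rewrite -E.
    - have e1 := h2 xa; have lt : y < a by rewrite -og_subr_gt0 (lt_le_trans e0).
      split; first by rewrite lt_eqF.
        by rewrite [RHS]og_ltNge ltW// og_ltNge ltW.
      by rewrite (psiB Hpsi) ?lt_eqF// -pe; apply: (psi_le Hpsi).
    - have e1 := h1 ax; have lt : a < y by rewrite -og_subr_gt0 (lt_le_trans e0).
      split; [by rewrite gt_eqF | by rewrite lt ax |].
      by rewrite -pe; apply: (psi_le Hpsi).
  split => //; apply/le_anti/andP; split => //.
  have yln : y - l != 0.
    by case: yl => E; [|rewrite -oppr_eq0 opprB]; rewrite E gt_eqF.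
  have pyl : psi (y - l) = c.
    by case: yl => E; [|rewrite (psiB Hpsi) -1?subr_eq0//]; rewrite E pe.
  have [la|la] := eqVneq l a; first by rewrite -la pyl.
  have E : y - a = (y - l) + (l - a) by rewrite addrA subrK.
  rewrite E -pyl; apply: (psi_add_ge Hpsi) => //; rewrite ?subr_eq0// -?E ?subr_eq0//.
  by rewrite pyl; apply: psi2 => //; rewrite eq_sym.
exists y => // a aF Aa.
have aF0 : a \in 0 :: F by rewrite inE aF orbT.
have [E|ne] := eqVneq (psi (x - a)) c.
  by rewrite E; apply: yF' => //; rewrite mem_filter aF0 E eqxx.
have lt : psi (x - a) < c by rewrite lt_neqAle ne a0max.
have [y0 sy py] : [/\ y != a0, (a0 < y) = (a0 < x) & psi (y - a0) = c].
  by apply: yF' => //; rewrite mem_filter a0F eqxx.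
have [||d0 dp ds] := @dominated_add _ _ _ Hpsi (x - a) (- (x - a0)).
- exact: xa0.
- by move=> _; rewrite (psiN Hpsi)// xa0.
have dE : x - a - (x - a0) = a0 - a by rewrite opprB [LHS]addrC addrA subrK.
rewrite dE in d0 dp ds.
have [||f0 fp fs] := @dominated_add _ _ _ Hpsi (a0 - a) (y - a0) => //.
  by move=> _; rewrite dp py.
have fE : a0 - a + (y - a0) = y - a by rewrite addrC addrA subrK.
rewrite fE in f0 fp fs; split.
- by rewrite -subr_eq0.
- by rewrite -og_subr_gt0 fs ds og_subr_gt0.
- by rewrite fp dp.
Qed.

(** For a single u, let e' = psi u: then e < 0 because psi u is in [P], and psi u = e + psi e < psi
    e. Integrals are unique, so F involves finitely many u. *)
Lemma small_ex (F : seq G) : exists e, [/\ A e, 0 < e &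
  forall u, A u -> u != 0 -> der u \in F -> psi u < psi e].
Proof.
have step u : A u -> u != 0 -> exists e, [/\ A e, 0 < e & psi u < psi e].
  move=> Au u0; have [e [Ae e0 eE]] := A_int (A_psi Au u0).
  have en : e < 0 by apply/(P_der HT e0); rewrite eE; apply: (P_psi HT).
  exists (- e); split; [exact: subspaceN | by rewrite og_oppr_gt0 |].
  by rewrite (psiN Hpsi)// -eE /der -[ltRHS]add0r og_ltD2r.
elim: F => [|f F [e [Ae e0 IH]]].
  have [u [Au u0 _]] := A_int (subspace0 sA).
  by have [e [Ae e0 _]] := step u Au u0; exists e.
case: (pselect (exists u, [/\ A u, u != 0 & der u = f])) => [[u [Au u0 uE]]|nex].
  have uniq v : A v -> v != 0 -> der v = f -> v = u.
    by move=> Av v0 vE; apply: (der_inj Hpsi) => //; rewrite vE uE.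
  have [le|lt] := boolP (psi e <= psi u).
    have [d [Ad d0 dE]] := step u Au u0; exists d; split => // v Av v0.
    rewrite inE => /orP[/eqP/(uniq _ Av v0)->//|vF].
    by apply: lt_trans (IH _ Av v0 vF) (le_lt_trans le dE).
  exists e; split => // v Av v0; rewrite inE => /orP[/eqP/(uniq _ Av v0)->//|].
    by rewrite og_ltNge.
  exact: IH.
exists e; split => // v Av v0; rewrite inE => /orP[/eqP vf|]; last exact: IH.
by case: nex; exists v.
Qed.

Lemma Span_end_inv x h : ~ escapes x -> Span x h ->
  exists b (c : k), A b /\ forall y, h y = b + c *: y.
Proof.
move=> nok Sh; case: Sh nok => {x h}.
- by move=> x b f Ab h _; exists b, 0; split=> // y; rewrite scale0r addr0.
- by move=> x b c f _ Ab h _; exists b, c.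
- by move=> x c g f okx.
Qed.

(** If f x and g x differ, both integrals are infinitesimal against f x - g x, so psi (u - v)
    exceeds psi (f x - g x) = psi (u' - v'); but [der_sub] makes the two equal. *)
Lemma no_integral_unique x f g u v : ~ A x -> Span x f -> Span x g ->
  no_integral x f -> no_integral x g -> u != 0 -> v != 0 -> der u = f x -> der v = g x ->
  f x = g x.
Proof.
move=> nAx Sf Sg bf bg u0 v0 uE vE; apply/eqP/negPn/negP => fg.
have vs := value_subspace x; have vp := value_psi nAx.
have vd : value x (f x - g x) by exists (fun y => f y - g y) => //; exact: Span_sub.
have d0 : f x - g x != 0 by rewrite subr_eq0.
have uv : u != v by apply: contra_neq fg => E; rewrite -uE E.
have gu : psi (f x - g x) < psi u.
  by apply: (no_integral_gap Hpsi vs vp u0 _ (no_integral_value bf u0 uE)); rewrite ?uE//; exists f.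
have gv : psi (f x - g x) < psi v.
  by apply: (no_integral_gap Hpsi vs vp v0 _ (no_integral_value bg v0 vE)); rewrite ?vE//; exists g.
have [_ E _] := der_sub Hpsi u0 v0 uv.
have := @psi_add_gt _ _ _ Hpsi u (- v) (psi (f x - g x)) u0.
rewrite oppr_eq0 subr_eq0 (psiN Hpsi)// => /(_ v0 uv gu gv).
by rewrite -E uE vE ltxx.
Qed.

(** Without an exceptional pair (b, c), [gap_cond] is vacuous. Otherwise the integral u of b + c x
    is infinitesimal over A, and y is chosen with b + c y = e', where e in A has the sign of u and
    is negligible against the integrals v of all b + c a, a in F. Then c (x - a) = u' - v' and c (y
    - a) = e' - v' both behave like - v. *)
Lemma approx_end x (F : seq G) : ~ A x -> ~ escapes x -> exists2 y, A y &
  same_cut F x y /\ (forall a, a \in F -> A a -> psi (y - a) = psi (x - a)) /\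
  gap_cond x y.
Proof.
move=> nAx nok.
pose badp b (c : k) := forall b' (c' : k), A b' -> b' + c' *: x != 0 ->
  der (b' + c' *: x) != b + c *: x.
case: (pselect (exists b c, A b /\ badp b c)) => [[b [c [Ab bbc]]]|nbad]; last first.
  have [y Ay h] := approx_psi F nAx nok; exists y => //.
  split; first by move=> a aF Aa; have [] := h a aF Aa.
  split; first by move=> a aF Aa; have [] := h a aF Aa.
  by move=> b c Ab bbc; case: nbad; exists b, c.
have badE b' (c' : k) : badp b' c' -> no_integral x (fun y => b' + c' *: y).
  move=> bb h Sh h0; have [b2 [c2 [Ab2 hE]]] := Span_end_inv nok Sh.
  by rewrite hE in h0 *; apply: bb.
have SpE b' (c' : k) : A b' -> Span x (fun y => b' + c' *: y).
  by move=> Ab'; apply: (@Span_end x b' c').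
have [u u0 uE] := int_ex (b + c *: x).
have c0 : c != 0.
  apply/eqP => c0; have [v [Av v0 vE]] := A_int Ab.
  have := bbc v 0 Av; rewrite c0 !scale0r !addr0 vE eqxx => /(_ v0).
  by [].
have gap := no_integral_gap Hpsi (value_subspace x) (value_psi nAx) u0 _
  (no_integral_value (badE _ _ bbc) u0 uE).
have {}gap h : A h -> h != 0 -> psi h < psi u.
  move=> Ah; apply: gap; last by exists (fun=> h) => //; exact: Span_cst.
  by rewrite uE; exists (fun y => b + c *: y) => //; apply: SpE.
have [e0 [Ae0 e00 e0F]] := small_ex [seq b + c *: a | a <- F].
pose e := if 0 < u then e0 else - e0.
have Ae : A e by rewrite /e; case: ifP => // _; apply: subspaceN.
have en : e != 0 by rewrite /e; case: ifP => _; rewrite ?oppr_eq0 gt_eqF.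
have eu : (0 < e) = (0 < u).
  by rewrite /e; case: (boolP (0 < u)) => // _; rewrite og_oppr_gt0 og_ltNge ltW.
have pe : psi e = psi e0 by rewrite /e; case: ifP => // _; rewrite (psiN Hpsi) ?gt_eqF.
have Ade : A (der e) by apply: (subspaceD sA) => //; apply: A_psi.
pose y := c^-1 *: (der e - b).
have yE : b + c *: y = der e by rewrite /y scalerA divff// scale1r subrKC.
have key a : a \in F -> A a ->
    [/\ y != a, (a < y) = (a < x) & psi (y - a) = psi (x - a)].
  move=> aF Aa; have Aca : A (b + c *: a) by apply: subspaceD => //; apply: subspaceZ.
  have [v [Av v0 vE]] := A_int Aca.
  have pv : psi v < psi e.
    by rewrite pe; apply: e0F => //; rewrite vE; apply: map_f.
  have subE z w : b + c *: z = der w -> z - a = c^-1 *: (der w - der v).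
    move=> <-; rewrite vE opprD addrACA subrr add0r -scalerBr scalerA mulVf//.
    by rewrite scale1r.
  have main z w : b + c *: z = der w -> w != 0 -> psi v < psi w ->
      [/\ z != a, (a < z) = ((0 < c^-1) == (0 < - v)) & psi (z - a) = psi v].
    move=> zE w0 lt; have E := subE _ _ zE.
    have wv : w != v by apply: contraTneq lt => ->; rewrite ltxx.
    have [d0 dp ds] := der_sub Hpsi w0 v0 wv.
    rewrite -subr_eq0 in d0.
    have ci : c^-1 != 0 by rewrite invr_eq0.
    have [||f0 fp fs] := @dominated_add _ _ _ Hpsi (- v) w.
    - by rewrite oppr_eq0.
    - by move=> _; rewrite (psiN Hpsi).
    rewrite addrC in f0 fp fs; split.
    - by rewrite -subr_eq0 E; apply: ov_scale_neq0.
    - by rewrite -og_subr_gt0 E ov_scale_gt0// ds fs.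
    - by rewrite E (psiZ Hpsi ci d0) dp fp (psiN Hpsi).
  have [y0 sy py] := main _ _ yE en pv.
  have [x0 sx px] := main _ _ (esym uE) u0 (gap _ Av v0).
  by split=> //; rewrite ?sy ?sx// py px.
exists y.
  by apply: (subspaceZ sA); apply: subspaceB.
split; first by move=> a aF Aa; have [] := key a aF Aa.
split; first by move=> a aF Aa; have [] := key a aF Aa.
(* Only one pair has to be compared: another exceptional pair has b2 + c2 x = b + c x, so c2 = c
   because x is outside A. *)
move=> b2 c2 Ab2 bb2; have [v v0 vE] := int_ex (b2 + c2 *: x).
have E := no_integral_unique nAx (SpE _ c2 Ab2) (SpE _ c Ab) (badE _ _ bb2) (badE _ _ bbc)
  v0 u0 vE uE.
have cE : c2 = c.
  apply/eqP/negPn/negP => cc; rewrite -subr_eq0 in cc.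
  have := subspace_scale_notin sA cc nAx; apply.
  rewrite scalerBl; have -> : c2 *: x - c *: x = b - b2; last exact: subspaceB.
  by apply/eqP; rewrite subr_eq addrAC eq_sym subr_eq -E addrC.
have bE : b2 = b by move: E; rewrite cE => /addIr.
rewrite bE cE yE -uE; split.
  by move/(P_der HT en); rewrite og_lt0// eu -og_lt0// => /(P_der HT u0).
by move/(P_der HT u0); rewrite og_lt0// -eu -og_lt0// => /(P_der HT en).
Qed.

(** For an escaping x and positive depth, [next_pt x] is approximated first, by y1. As y1 inherits
    membership in [P], it is psi w for some w in A, and [center x + w], with w of the right sign, is
    the required y. *)
Lemma approx m F x : ~ A x -> exists2 y, A y & approx_cond m F x y.
Proof.
elim: m F x => [|m IH] F x nAx; case: (pselect (escapes x)) => okx.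
- have [u [Au u0 _]] := A_int (subspace0 sA).
  have [D [AD D0 _]] := A_pos (A_psi Au u0) (P_psi HT u0).
  have ex0 : exists2 a, a \in 0 :: F & A a.
    by exists 0; [rewrite mem_head | exact: subspace0 sA].
  have [y [e [Ay e0 _ _ ya]]] := bracket nAx AD D0 ex0.
  exists y => //; split => // a aF Aa.
  have [|h1 h2] := ya a _ Aa; first by rewrite inE aF orbT.
  case: (og_ltgtP a x) => [ax|E|xa].
  + have lt : a < y by rewrite -og_subr_gt0 (lt_le_trans e0)// h1.
    by rewrite lt ax gt_eqF.
  + by case: nAx; rewrite -E.
  + have lt : y < a by rewrite -og_subr_gt0 (lt_le_trans e0)// h2.
    by rewrite lt_eqF// ![a < _]og_ltNge !ltW.
- by have [y Ay [h1 [h2 h3]]] := approx_end F nAx okx; exists y.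
- have [Ap nAn] := centerP okx; have [F0 hP] := approx_cond_P nAn.
  (* F0 puts y1 into [P]. The values psi (a - [center x]) ensure that the same summand dominates in
     w - (a - [center x]) as in (x - [center x]) - (a - [center x]). *)
  pose F1 := F ++ F0 ++ [seq psi (a - center x) | a <- F].
  have [y1 Ay1 Cy1] := IH F1 _ nAn.
  have z0 : x - center x != 0 by apply: notin_sub_neq0.
  have Py1 : P y1.
    have [_ ] : (P y1 <-> P (next_pt x)).
      apply: (hP m) => //; apply: approx_cond_mono Cy1 => // a aF.
      by rewrite !mem_cat aF orbT.
    by apply; apply: (P_psi HT).
  have [D [AD D0 DE]] := A_pos Ay1 Py1.
  pose w := if 0 < x - center x then D else - D.
  have Aw : A w by rewrite /w; case: ifP => // _; apply: subspaceN.
  have w0 : w != 0 by rewrite /w; case: ifP => _; rewrite ?oppr_eq0 gt_eqF.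
  have ws : (0 < w) = (0 < x - center x).
    rewrite /w; case: (boolP (0 < x - center x)) => // _.
    by rewrite og_oppr_gt0 og_ltNge ltW.
  have pw : psi w = y1 by rewrite /w; case: ifP => // _; rewrite (psiN Hpsi) ?gt_eqF.
  exists (center x + w); first exact: subspaceD.
  have yE : center x + w - center x = w by rewrite addrC addKr.
  split => //.
    move=> a aF Aa; have [->|ap] := eqVneq a (center x).
      by rewrite -subr_eq0 yE w0 -og_subr_gt0 yE ws og_subr_gt0.
    have d0 : a - center x != 0 by rewrite subr_eq0.
    have Ad : A (a - center x) by apply: subspaceB.
    have pF : psi (a - center x) \in F1.
      by rewrite !mem_cat; apply/orP; right; apply/orP; right; exact: map_f.
    have [sg _ _] : [/\ same_cut F1 (next_pt x) y1, True & True] by case: (m) Cy1 => [|?] [].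
    have [y1n y1s] := sg _ pF (A_psi Ad d0).
    have xE : x - a = (x - center x) - (a - center x) by rewrite opprB addrA subrK.
    have yaE : center x + w - a = w - (a - center x) by rewrite opprB addrA [w + _]addrC.
    rewrite -subr_eq0 -og_subr_gt0 -[RHS]og_subr_gt0 xE yaE.
    have nxn := next_notin okx (A_psi Ad d0).
    have [lt|eq|gt] := og_ltgtP (next_pt x) (psi (a - center x)).
    + have [||_ _ ->] := @dominated_add _ _ _ Hpsi (x - center x) (- (a - center x)) => //.
        by move=> _; rewrite (psiN Hpsi).
      have [||-> _ ->] := @dominated_add _ _ _ Hpsi w (- (a - center x)) => //.
      move=> _; rewrite (psiN Hpsi)// pw og_ltNge le_eqVlt negb_or eq_sym y1n y1s.
      by rewrite -og_leNgt ltW.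
    + by rewrite eq eqxx in nxn.
    + rewrite ![_ - (a - _)]addrC.
      have [||_ _ ->] := @dominated_add _ _ _ Hpsi (- (a - center x)) (x - center x).
      * by rewrite oppr_eq0.
      * by move=> _; rewrite (psiN Hpsi).
      have [||-> _ ->] := @dominated_add _ _ _ Hpsi (- (a - center x)) w => //.
      * by rewrite oppr_eq0.
      * by move=> _; rewrite (psiN Hpsi)// pw y1s.
  move=> _; rewrite yE pw; apply: approx_cond_mono Cy1 => // a aF.
  by rewrite mem_cat aF.
- by have [y Ay [h1 [h2 h3]]] := approx_end F nAx okx; exists y.
Qed.

(** * Terms and formulas near x *)

Definition term_germ x (u : option G) (w : G -> option G) :=
  (u = None /\ ev x (fun y => w y = None)) \/
  exists2 f, Span x f & u = Some (f x) /\ ev x (fun y => w y = Some (f y)).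

Definition in_infty (u : option G) := if u is Some a then A a else True.

Local Notation M := (H_structure psi P).

Lemma ev_term n (t : term k n) x (vx : 'I_n -> M) (vy : G -> 'I_n -> M) :
  ~ A x -> (forall i, term_germ x (vx i) (fun y => vy y i)) ->
  term_germ x (eval vx t) (fun y => eval (vy y) t).
Proof.
move=> nAx hv; elim: t => //=.
- right; exists (fun=> 0); first by apply/Span_cst/(subspace0 sA).
  by split => //; apply: ev_all.
- by left; split => //; apply: ev_all.
- move=> t [[-> e]|[f Sf [-> e]]]; [left|right].
    by split => //; apply: ev_mono e => y Ay ->.
  exists (fun y => - f y).
    by apply: Span_ext (Span_scale (-1) Sf) => y; rewrite scaleN1r.
  by split => //; apply: ev_mono e => y Ay ->.
- move=> t1 [[-> e1] t2 _|[f Sf [-> e1]] t2 [[-> e2]|[g Sg [-> e2]]]].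
  + by left; split => //; apply: ev_mono e1 => y Ay ->.
  + by left; split => //; apply: ev_mono (ev_and e1 e2) => y Ay [-> ->].
  + right; exists (fun y => f y + g y); first exact: Span_add.
    by split => //; apply: ev_mono (ev_and e1 e2) => y Ay [-> ->].
- move=> c t [[-> e]|[f Sf [-> e]]]; [left|right].
    by split => //; apply: ev_mono e => y Ay ->.
  exists (fun y => c *: f y); first exact: Span_scale.
  by split => //; apply: ev_mono e => y Ay ->.
- move=> t [[-> e]|[f Sf [-> e]]].
    by left; split => //; apply: ev_mono e => y Ay ->.
  (* [germ] separates the branches of psi: if f vanishes identically, the term is infinity near x;
     otherwise f y is nonzero near x. *)
  case: (germ Sf nAx) => [f0|[f0 fs _]].
    left; rewrite /= f0 eqxx; split => //.
    by apply: ev_mono e => y Ay -> /=; rewrite f0 eqxx.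
  right; have [h Sh [hx he]] := Span_psi Sf nAx f0; exists h => //.
  rewrite /= (negbTE f0) hx; split => //.
  apply: ev_mono (ev_and e (ev_and fs he)) => y Ay [-> [[fy0 _] hy]] /=.
  by rewrite (negbTE fy0) hy.
Qed.

Lemma ev_formula n (f : formula k n) x (vx : 'I_n -> M) (vy : G -> 'I_n -> M) :
  ~ A x -> quantifier_free f ->
  (forall i, term_germ x (vx i) (fun y => vy y i)) ->
  ev x (fun y => sat f (vy y) <-> sat f vx).
Proof.
move=> nAx; elim: f vx vy => //=.
- by move=> {}n vx vy _ _; apply: ev_all.
- move=> {}n t1 t2 vx vy _ hv.
  have [[-> e1]|[f Sf [-> e1]]] := ev_term t1 nAx hv;
  have [[-> e2]|[g Sg [-> e2]]] := ev_term t2 nAx hv.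
  + by apply: ev_mono (ev_and e1 e2) => y Ay [-> ->].
  + by apply: ev_mono (ev_and e1 e2) => y Ay [-> ->].
  + by apply: ev_mono (ev_and e1 e2) => y Ay [-> ->].
  + case: (germ (Span_sub Sf Sg) nAx) => [fg|[fg fs _]].
      have {}fg y : f y = g y by apply/eqP; rewrite -subr_eq0 fg.
      by apply: ev_mono (ev_and e1 e2) => y Ay [-> ->]; rewrite !fg.
    apply: ev_mono (ev_and fs (ev_and e1 e2)) => y Ay [[fgy _] [-> ->]].
    by split => -[E]; [move: fgy|move: fg]; rewrite E subrr eqxx.
- move=> {}n t1 t2 vx vy _ hv.
  have [[-> e1]|[f Sf [-> e1]]] := ev_term t1 nAx hv;
  have [[-> e2]|[g Sg [-> e2]]] := ev_term t2 nAx hv.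
  + by apply: ev_mono (ev_and e1 e2) => y Ay [-> ->].
  + by apply: ev_mono (ev_and e1 e2) => y Ay [-> ->].
  + by apply: ev_mono (ev_and e1 e2) => y Ay [-> ->].
  + case: (germ (Span_sub Sg Sf) nAx) => [fg|[fg fs _]].
      have {}fg y : g y = f y by apply/eqP; rewrite -subr_eq0 fg.
      by apply: ev_mono (ev_and e1 e2) => y Ay [-> ->] /=; rewrite !fg !ltxx.
    apply: ev_mono (ev_and fs (ev_and e1 e2)) => y Ay [[_ fgy] [-> ->]] /=.
    by rewrite -og_subr_gt0 fgy og_subr_gt0.
- move=> {}n t vx vy _ hv.
  have [[-> e]|[f Sf [-> e]]] := ev_term t nAx hv.
    by apply: ev_mono e => y Ay ->.
  by apply: ev_mono (ev_and e (ev_P Sf nAx)) => y Ay [->].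
- move=> {}n f IH vx vy qf hv.
  by apply: ev_mono (IH vx vy qf hv) => y Ay ->.
all: move=> {}n f IHf g IHg vx vy /andP[qf qg] hv.
all: by apply: ev_mono (ev_and (IHf vx vy qf hv) (IHg vx vy qg hv)) => y Ay [-> ->].
Qed.

Lemma existentially_closed n (f : formula k n.+1) (x : M) (v : 'I_n -> M) :
  quantifier_free f -> (forall i, in_infty (v i)) -> sat f (extend x v) ->
  exists2 y : M, in_infty y & sat f (extend y v).
Proof.
move=> qf Av fx; case: x fx => [x|] fx; last by exists None.
case: (pselect (A x)) => [Ax|nAx]; first by exists (Some x).
have [|m [F hF]] := @ev_formula _ f x (extend (Some x : M) v)
  (fun y => extend (Some y : M) v) nAx qf.
  move=> i; rewrite /extend; case: unliftP => [j _|_].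
    have := Av j; case: (v j) => [a|] /= Aj; [right|left].
      by exists (fun=> a); [exact: Span_cst | split=> //; apply: ev_all].
    by split => //; apply: ev_all.
  by right; exists id; [exact: Span_id | split=> //; apply: ev_all].
have [y Ay Cy] := approx m F nAx.
by exists (Some y) => //; apply/(hF y Ay Cy).
Qed.

End Approximation.

(** * Extending partial isomorphisms *)

Section ClosedTriple.
Variables (k : realFieldType) (G : orderedVectType k) (psi : G -> G).
Variable P : set G.
Hypothesis closedG : closed_H_triple psi P.
Local Notation der := (der psi).
Let HT : H_triple psi P := proj1 closedG.

Lemma closed_int g : exists2 u : G, u != 0 & der u = g.
Proof.
have : [set: G]%classic g by [].
by rewrite (closed_prime (proj2 closedG)) => -[u u0 uE]; exists u.
Qed.

(** So [P] equals Psi in a closed triple: an element v' of [P] has v < 0, hence v' < psi v, and Psi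
    is downward closed. *)
Lemma closed_P g : P g -> exists2 u, 0 < u & psi u = g.
Proof.
move=> Pg; have [v v0 vE] := closed_int g.
have vn : v < 0 by apply/(P_der HT v0); rewrite vE.
have [||u u0 uE] := @closed_Psi _ _ (proj2 closedG) g (psi v); first by exists v.
  by rewrite -vE /der -[leRHS]add0r og_leD2r ltW.
case: (boolP (0 < u)) => up; first by exists u.
exists (- u); first by rewrite og_gt0N.
by rewrite (psiN (H_triple_couple HT)).
Qed.

End ClosedTriple.

(** * Adjoining one element to a subspace *)

Section AdjoinOne.
Variables (k : realFieldType) (G : orderedVectType k) (psi : G -> G).
Hypothesis Hpsi : H_couple_over psi.
Local Notation der := (der psi).

Lemma adjoin_psi a y (c : k) : y != 0 -> c != 0 ->
    (a != 0 -> psi a != psi y) ->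
  a + c *: y != 0 /\
  if (a != 0) && (psi a < psi y) then
    psi (a + c *: y) = psi a /\ (0 < a + c *: y) = (0 < a)
  else psi (a + c *: y) = psi y /\ (0 < a + c *: y) = (0 < c *: y).
Proof.
move=> y0 c0; have cy0 := ov_scale_neq0 c0 y0.
have pcy : psi (c *: y) = psi y by rewrite (psiZ Hpsi).
have [->|a0 /(_ isT) ay] /= := eqVneq a 0; first by rewrite add0r pcy.
case: ifP => [lt|nlt].
  by have [||-> -> ->] := @dominated_add _ _ _ Hpsi a (c *: y) => // _; rewrite pcy.
have [||] := @dominated_add _ _ _ Hpsi (c *: y) a => //.
  by move=> _; rewrite pcy; case: (og_ltgtP (psi a) (psi y)) nlt ay => // [->//|->]; rewrite eqxx.
by rewrite addrC pcy => -> -> ->.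
Qed.

(** For elements of one sign, psi a < psi y means that a is farther from 0, and the increasing map
    x' preserves this. It serves when y' is given and y is its integral. *)
Lemma psi_lt_der a y : a != 0 -> y != 0 -> psi a != psi y -> (0 < a) = (0 < y) ->
  (psi a < psi y) = if 0 < y then der y < der a else der a < der y.
Proof.
move=> a0 y0 ay sg; rewrite !(der_lt Hpsi)//.
have Na0 : - a != 0 by rewrite oppr_eq0.
have Ny0 : - y != 0 by rewrite oppr_eq0.
have oppD (u v : G) : (- u < - v) = (v < u) by rewrite -og_subr_gt0 opprK addrC og_subr_gt0.
have [lt|eq|gt] := og_ltgtP (psi a) (psi y); last 2 first.
- by rewrite eq eqxx in ay.
- rewrite [LHS]og_ltNge (ltW gt); case: ifP => yp; apply/esym/negbTE; rewrite -og_leNgt ltW//.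
    by apply: (psi_lt_sign Hpsi).
  rewrite -oppD; apply: (psi_lt_sign Hpsi) => //; rewrite ?(psiN Hpsi)//.
  by rewrite og_gt0N// yp.
- rewrite lt; case: ifP => yp; apply/esym; first by apply: (psi_lt_sign Hpsi); rewrite // sg.
  rewrite -oppD; apply: (psi_lt_sign Hpsi) => //; rewrite ?(psiN Hpsi)//.
  by rewrite og_gt0N// sg yp.
Qed.

End AdjoinOne.

Section AdjoinIntegral.
Variables (k : realFieldType) (G : orderedVectType k) (psi : G -> G).
Variable P : set G.
Hypothesis closedG : closed_H_triple psi P.
Local Notation der := (der psi).
Let HT : H_triple psi P := proj1 closedG.
Let Hpsi := H_triple_couple HT.
Variables (S : set G) (y : G).
Hypothesis sS : subspace S.
Hypothesis S_psi : forall a, S a -> a != 0 -> S (psi a).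
Hypothesis y0 : y != 0.
Hypothesis Sdy : S (der y).
Hypothesis psi_neq : forall a, S a -> a != 0 -> psi a != psi y.

(* Describes P on S + k y in terms of order and psi only, for y with y' in S: an
   element a + c y of S + k y is psi y + ((a - y') + (1 + c) y). *)
Lemma P_adjoin_int a (d : k) : S a ->
  P (psi y + (a + d *: y)) <->
  a + d *: y <= 0 \/ psi y < psi (a + d *: y).
Proof.
(* Writing psi y = w' turns membership in [P] of psi y + e into the sign of w + e, by
   [P_der_add]. *)
move=> Sa; have [w w0 wE] := closed_int closedG (psi y).
have wn : w < 0 by apply/(P_der HT w0); rewrite wE; apply: (P_psi HT).
have yw : psi y < psi w by rewrite -wE /der -[ltRHS]add0r og_ltD2r.
pose e := a + d *: y.
have epsi : e != 0 -> psi e = psi y \/ S (psi e).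
  rewrite /e; have [->|d0] := eqVneq d 0.
    by rewrite scale0r addr0 => a0; right; apply: S_psi.
  move=> _; have [_] := @adjoin_psi _ _ _ Hpsi a y d y0 d0 (psi_neq Sa).
  by case: ifP => [/andP[a0 _]|_] [-> _]; [right; apply: S_psi | left].
have yNS b : S b -> b != y.
  move=> Sb; apply/eqP => by_.
  have b0 : b != 0 by rewrite by_.
  by have := psi_neq Sb b0; rewrite by_ eqxx.
(* Nothing in [psi (S + k y)] lies in the interval (psi y, psi w]: adding the
   small element w to y - b, for b in S, does not change its sign. *)
have gap b : S b -> (0 < y + w - b) = (0 < y - b) /\ y + w != b.
  move=> Sb.
  have yb0 : y - b != 0 by rewrite subr_eq0 eq_sym yNS.
  have le : psi (y - b) <= psi y.
    have [->|b0] := eqVneq b 0; first by rewrite subr0.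
    have Nb0 : - b != 0 by rewrite oppr_eq0.
    have /= := @adjoin_psi _ _ _ Hpsi (- b) y 1 y0 (oner_neq0 _).
    rewrite scale1r addrC Nb0 (psiN Hpsi)// => /(_ (fun=> psi_neq Sb b0))[_].
    by case: ifP => [/ltW lt|_] [-> _].
  have [||n0 _ s] := @dominated_add _ _ _ Hpsi (y - b) w => //.
    by move=> _; apply: le_lt_trans yw.
  by rewrite addrAC s; split => //; rewrite -subr_eq0 addrAC.
have pw : psi w = der y - (y + w).
  have -> : der y = y + der w by rewrite wE.
  by rewrite opprD addrA [y + _]addrC addrK /der addrC addKr.
rewrite -wE -/e; have [e00|e0] := eqVneq e 0.
  rewrite e00 addr0 lexx; split; first by left.
  by move=> _; apply/(P_der HT w0).
have ew : psi e != psi w.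
  case: (epsi e0) => [->|Spe]; first by rewrite lt_eqF.
  apply/eqP => E; have [|_] := gap (der y - psi e); first exact: subspaceB.
  by rewrite E pw subKr eqxx.
have [h1 h2] := P_der_add HT w0 (fun _ => ew).
rewrite wE; split.
  rewrite -{1}wE => /h1 lt; have [ltw|eq|gt] := og_ltgtP (psi e) (psi w).
  - left; have [||_ _ s] := @dominated_add _ _ _ Hpsi e w => //.
    rewrite og_leNgt -s addrC og_ltNge negbK; exact: ltW.
  - by rewrite eq eqxx in ew.
  - by right; apply: lt_trans gt.
rewrite -{2}wE => h; apply: h2.
have [en|ep] := boolP (e < 0); first exact: og_addr_lt0.
case: h => [|lt]; first by rewrite le_eqVlt (negbTE e0) (negbTE ep).
case: (epsi e0) => [E|Spe]; first by rewrite E ltxx in lt.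
have lw : psi w < psi e.
  have [|g _] := gap (der y - psi e); first exact: subspaceB.
  have : 0 < y - (der y - psi e).
    by rewrite opprB addrA addrAC -opprB [der y - y]addrC addKr addrC og_subr_gt0.
  by rewrite -g opprB addrA addrAC -[y + w - der y]opprB -pw addrC og_subr_gt0.
have [||n0 _ s] := @dominated_add _ _ _ Hpsi w e => //.
by rewrite og_lt0// s -og_lt0.
Qed.

End AdjoinIntegral.

(** * Partial isomorphisms and their one-element extensions *)

Section PartialIso.
Variables (k : realFieldType).
Variables (G1 : orderedVectType k) (psi1 : G1 -> G1) (P1 : set G1).
Variables (G2 : orderedVectType k) (psi2 : G2 -> G2) (P2 : set G2).
Hypothesis HC1 : closed_H_triple psi1 P1.
Hypothesis HC2 : closed_H_triple psi2 P2.
Let HT1 : H_triple psi1 P1 := proj1 HC1.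
Let HT2 : H_triple psi2 P2 := proj1 HC2.
Let Hpsi1 := H_triple_couple HT1.
Let Hpsi2 := H_triple_couple HT2.
Local Notation der1 := (der psi1).
Local Notation der2 := (der psi2).

(* The graph of an isomorphism between substructures: injectivity and
   functionality both follow from sign preservation. *)
Record partial_iso (R : set (G1 * G2)) : Prop := PartialIso {
  piso0 : R (0, 0);
  pisoD : forall a b a' b', R (a, b) -> R (a', b') -> R (a + a', b + b');
  pisoZ : forall (c : k) a b, R (a, b) -> R (c *: a, c *: b);
  piso_gt0 : forall a b, R (a, b) -> (0 < a) = (0 < b);
  piso_psi : forall a b, R (a, b) -> a != 0 -> R (psi1 a, psi2 b);
  piso_P : forall a b, R (a, b) -> P1 a <-> P2 b
}.

Section Theory.
Variable R : set (G1 * G2).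
Hypothesis iR : partial_iso R.

Lemma pisoN a b : R (a, b) -> R (- a, - b).
Proof. by move=> h; rewrite -!scaleN1r; apply: (pisoZ iR). Qed.

Lemma pisoB a b a' b' : R (a, b) -> R (a', b') -> R (a - a', b - b').
Proof. by move=> h h'; apply: (pisoD iR) => //; apply: pisoN. Qed.

Lemma piso_neq0 a b : R (a, b) -> (a != 0) = (b != 0).
Proof.
move=> h; have E := piso_gt0 iR h; have E' := piso_gt0 iR (pisoN h).
apply/idP/idP => [a0|b0].
- apply: contraTneq a0 => b0; rewrite b0 oppr0 ltxx in E E'.
  by case: (og_ltgtP 0 a) E E' => [->//|->|]; rewrite ?eqxx// og_oppr_gt0 => ->.
- apply: contraTneq b0 => a0; rewrite a0 oppr0 ltxx in E E'.
  by case: (og_ltgtP 0 b) E E' => [->//|->|]; rewrite ?eqxx// og_oppr_gt0 => ->.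
Qed.

Lemma piso_lt a b a' b' : R (a, b) -> R (a', b') -> (a < a') = (b < b').
Proof.
by move=> h h'; rewrite -og_subr_gt0 -[RHS]og_subr_gt0; apply/(piso_gt0 iR)/pisoB.
Qed.

Lemma piso_der a b : R (a, b) -> a != 0 -> R (der1 a, der2 b).
Proof. by move=> h a0; apply: (pisoD iR) => //; apply: (piso_psi iR). Qed.

Lemma piso_eql a b b' : R (a, b) -> R (a, b') -> b = b'.
Proof.
move=> h h'; have := piso_neq0 (pisoB h h'); rewrite subrr eqxx.
by move/esym/negbFE; rewrite subr_eq0 => /eqP.
Qed.

Lemma piso_eqr a a' b : R (a, b) -> R (a', b) -> a = a'.
Proof.
move=> h h'; have := piso_neq0 (pisoB h h'); rewrite subrr eqxx.
by move/negbFE; rewrite subr_eq0 => /eqP.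
Qed.

Definition dom : set G1 := [set a | exists b, R (a, b)].
Definition ran : set G2 := [set b | exists a, R (a, b)].

Lemma dom_subspace : subspace dom.
Proof.
split; first by exists 0; apply: (piso0 iR).
- by move=> a a' [b h] [b' h']; exists (b + b'); apply: (pisoD iR).
- by move=> c a [b h]; exists (c *: b); apply: (pisoZ iR).
Qed.

Lemma ran_subspace : subspace ran.
Proof.
split; first by exists 0; apply: (piso0 iR).
- by move=> a a' [b h] [b' h']; exists (b + b'); apply: (pisoD iR).
- by move=> c a [b h]; exists (c *: b); apply: (pisoZ iR).
Qed.

Lemma dom_psi a : dom a -> a != 0 -> dom (psi1 a).
Proof. by move=> [b h] a0; exists (psi2 b); apply: (piso_psi iR). Qed.

Lemma ran_psi b : ran b -> b != 0 -> ran (psi2 b).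
Proof.
by move=> [a h] b0; exists (psi1 a); apply: (piso_psi iR); rewrite ?(piso_neq0 h).
Qed.

Definition adjoin y1 y2 : set (G1 * G2) :=
  [set u | exists a b (c : k), R (a, b) /\ u = (a + c *: y1, b + c *: y2)].

Lemma sub_adjoin y1 y2 : subset R (adjoin y1 y2).
Proof. by move=> [a b] h; exists a, b, 0; rewrite !scale0r !addr0. Qed.

Lemma mem_adjoin y1 y2 : adjoin y1 y2 (y1, y2).
Proof.
by exists 0, 0, 1; rewrite !scale1r !add0r; split => //; apply: (piso0 iR).
Qed.

Section Adjoin.
Variables (y1 : G1) (y2 : G2).
Hypothesis y10 : y1 != 0.
Hypothesis y20 : y2 != 0.
Hypothesis y12 : (0 < y1) = (0 < y2).
Hypothesis psi_neq : forall a b, R (a, b) -> a != 0 ->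
  [/\ psi1 a != psi1 y1, psi2 b != psi2 y2 &
      (psi1 a < psi1 y1) = (psi2 b < psi2 y2)].
Hypothesis Rpsi_y : adjoin y1 y2 (psi1 y1, psi2 y2).

(** By [psi_neq] the same summand of a + c y dominates on both sides. [P] is left out because
    [adjoin_integral] uses order and psi on the extension to settle [P] there. *)
Lemma adjoin_gt0_psi u v : adjoin y1 y2 (u, v) ->
  (0 < u) = (0 < v) /\ (u != 0 -> adjoin y1 y2 (psi1 u, psi2 v)).
Proof.
move=> [a [b [c [h [-> ->]]]]]; have [->|c0] := eqVneq c 0.
  rewrite !scale0r !addr0; split; first exact: (piso_gt0 iR).
  by move=> a0; apply/sub_adjoin/(piso_psi iR).
have [a0|a0] := eqVneq a 0.
  have b0 : b = 0 by apply/eqP; rewrite -[_ == _]negbK -(piso_neq0 h) a0 eqxx.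
  rewrite a0 b0 !add0r !ov_scale_gt0// y12; split => // _.
  by rewrite (psiZ Hpsi1)// (psiZ Hpsi2).
have [n1 n2 lt] := psi_neq h a0.
have [|u0] := @adjoin_psi _ _ _ Hpsi1 a y1 c y10 c0 => //.
have [|v0] := @adjoin_psi _ _ _ Hpsi2 b y2 c y20 c0 => //.
rewrite -(piso_neq0 h) a0 -lt /=; case: ifP => _ [-> ->] [-> ->].
  by split; [exact: (piso_gt0 iR) | move=> _; apply/sub_adjoin/(piso_psi iR)].
by rewrite !ov_scale_gt0// y12.
Qed.

Hypothesis P_y : forall a b (c : k), R (a, b) -> c != 0 ->
  P1 (a + c *: y1) <-> P2 (b + c *: y2).

Lemma adjoin_iso : partial_iso (adjoin y1 y2).
Proof.
split.
- exact/sub_adjoin/(piso0 iR).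
- move=> _ _ _ _ [a [b [c [h [-> ->]]]]] [a' [b' [c' [h' [-> ->]]]]].
  exists (a + a'), (b + b'), (c + c'); split; first exact: (pisoD iR).
  by rewrite !scalerDl; congr pair; apply: addrACA.
- move=> d _ _ [a [b [c [h [-> ->]]]]].
  exists (d *: a), (d *: b), (d * c); split; first exact: (pisoZ iR).
  by rewrite !scalerDr !scalerA.
- by move=> a b /adjoin_gt0_psi[].
- by move=> a b /adjoin_gt0_psi[].
- move=> _ _ [a [b [c [h [-> ->]]]]]; have [->|c0] := eqVneq c 0.
    by rewrite !scale0r !addr0; apply: (piso_P iR).
  exact: P_y.
Qed.

End Adjoin.

(** [P] fixes the common sign of y1 and y2. No psi1 a from the domain equals psi1 y1, as g1 - psi1 a
    would then be y1 itself. So [psi_lt_der] compares values through derivatives, and [P_adjoin_int]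
    expresses [P] by order and psi. *)
Lemma adjoin_integral g1 g2 y1 y2 : R (g1, g2) ->
  (forall a b, R (a, b) -> a != 0 -> der1 a != g1) ->
  y1 != 0 -> der1 y1 = g1 -> y2 != 0 -> der2 y2 = g2 ->
  partial_iso (adjoin y1 y2).
Proof.
move=> Rg nint y10 y1E y20 y2E.
have y12 : (0 < y1) = (0 < y2).
  apply/idP/idP => yp; apply: contraT; rewrite -og_lt0// => yn.
    have /(piso_P iR Rg) : P2 g2 by rewrite -y2E; apply/(P_der HT2).
    by rewrite -y1E => /(P_der HT1 y10); rewrite og_lt0// yp.
  have /(piso_P iR Rg) : P1 g1 by rewrite -y1E; apply/(P_der HT1).
  by rewrite -y2E => /(P_der HT2 y20); rewrite og_lt0// yp.
have Rg0 : forall w, R (w, y2) -> False.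
  move=> w Rw; have w0 : w != 0 by rewrite (piso_neq0 Rw).
  have := nint _ _ Rw w0; have := piso_der Rw w0; rewrite y2E => h.
  by rewrite (piso_eqr h Rg) eqxx.
have n1 a b : R (a, b) -> a != 0 -> psi1 a != psi1 y1.
  move=> h a0; apply/eqP => E.
  have : R (g1 - psi1 a, g2 - psi2 b) by apply: pisoB => //; apply: (piso_psi iR).
  rewrite E -y1E /der addrK => Ry.
  by have := nint _ _ Ry y10; rewrite y1E eqxx.
have n2 a b : R (a, b) -> a != 0 -> psi2 b != psi2 y2.
  move=> h a0; apply/eqP => E.
  have : R (g1 - psi1 a, g2 - psi2 b) by apply: pisoB => //; apply: (piso_psi iR).
  by rewrite E -y2E /der addrK => /Rg0.
have lt a b : R (a, b) -> a != 0 -> (psi1 a < psi1 y1) = (psi2 b < psi2 y2).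
  have main a' b' : R (a', b') -> a' != 0 -> (0 < a') = (0 < y1) ->
      (psi1 a' < psi1 y1) = (psi2 b' < psi2 y2).
    move=> h a0 s; have b0 : b' != 0 by rewrite -(piso_neq0 h).
    have s' : (0 < b') = (0 < y2) by rewrite -y12 -s (piso_gt0 iR h).
    rewrite (psi_lt_der Hpsi1)//; last exact: n1 h a0.
    rewrite (psi_lt_der Hpsi2)//; last exact: n2 h a0.
    have hd := piso_der h a0.
    by rewrite -y12 y1E y2E (piso_lt Rg hd) (piso_lt hd Rg).
  move=> h a0; have [s|s] := eqVneq (0 < a) (0 < y1); first exact: main.
  have b0 : b != 0 by rewrite -(piso_neq0 h).
  rewrite -(psiN Hpsi1 a0) -(psiN Hpsi2 b0); apply: main.
  - exact: pisoN.
  - by rewrite oppr_eq0.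
  - by rewrite og_gt0N//; case: (0 < a) (0 < y1) s => [] [].
have Rpsi : adjoin y1 y2 (psi1 y1, psi2 y2).
  exists g1, g2, (-1); split => //.
  by rewrite !scaleN1r -y1E -y2E /der addrC addKr addrC addKr.
have neq a b : R (a, b) -> a != 0 -> [/\ psi1 a != psi1 y1, psi2 b != psi2 y2 &
      (psi1 a < psi1 y1) = (psi2 b < psi2 y2)].
  by move=> h a0; split; [exact: n1 h a0 | exact: n2 h a0 | exact: lt].
have gp := adjoin_gt0_psi y10 y20 y12 neq Rpsi.
apply: adjoin_iso => // a b c h c0.
have shift (V : zmodType) (p q y w : V) : p + w = q + (p - (y + q) + (y + w)).
  by rewrite addrA opprD [- y - q]addrC (addrCA q p) addNKr -addrA addKr.
have E1 : a + c *: y1 = psi1 y1 + ((a - g1) + (1 + c) *: y1).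
  by rewrite -y1E /der scalerDl scale1r -shift.
have E2 : b + c *: y2 = psi2 y2 + ((b - g2) + (1 + c) *: y2).
  by rewrite -y2E /der scalerDl scale1r -shift.
rewrite E1 E2.
have hd : adjoin y1 y2 ((a - g1) + (1 + c) *: y1, (b - g2) + (1 + c) *: y2).
  by exists (a - g1), (b - g2), (1 + c); split => //; apply: pisoB.
have Adom a' : dom a' -> a' != 0 -> psi1 a' != psi1 y1.
  by move=> [b' h'] a0; apply: n1 h' a0.
have Aran b' : ran b' -> b' != 0 -> psi2 b' != psi2 y2.
  by move=> [a' h'] b0; apply: (n2 _ _ h'); rewrite (piso_neq0 h').
have dg1 : dom (der1 y1) by exists g2; rewrite y1E.
have rg2 : ran (der2 y2) by exists g1; rewrite y2E.
have da : dom (a - g1) by exists (b - g2); apply: pisoB.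
have rb : ran (b - g2) by exists (a - g1); apply: pisoB.
have [i1 i1'] := P_adjoin_int HC1 dom_subspace dom_psi y10 dg1 Adom (1 + c) da.
have [i2 i2'] := P_adjoin_int HC2 ran_subspace ran_psi y20 rg2 Aran (1 + c) rb.
move: hd i1 i1' i2 i2'; move: (a - g1 + _) (b - g2 + _) => u v hd i1 i1' i2 i2'.
have [gt cl] := gp _ _ hd.
have adB u' v' u2 v2 : adjoin y1 y2 (u', v') -> adjoin y1 y2 (u2, v2) ->
    adjoin y1 y2 (u' - u2, v' - v2).
  move=> [p [q [d [hp [-> ->]]]]] [p' [q' [d' [hp' [-> ->]]]]].
  exists (p - p'), (q - q'), (d - d'); split; first exact: pisoB.
  by rewrite !scalerBl !opprD; congr pair; apply: addrACA.
have gt' : (0 < - u) = (0 < - v).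
  rewrite -[- u]sub0r -[- v]sub0r; have [|//] := gp (0 - u) (0 - v).
  by apply: adB => //; apply/sub_adjoin/(piso0 iR).
rewrite !og_oppr_gt0 in gt'.
have [u0|u0] := eqVneq u 0.
  have v0 : v = 0.
    by case: (og_ltgtP 0 v) gt gt' => [->|->//|->]; rewrite u0 ltxx.
  rewrite u0 v0 in i1 i1' i2 i2' *.
  by split => _; [apply: i2'|apply: i1']; left.
have ltE : (psi1 y1 < psi1 u) = (psi2 y2 < psi2 v).
  rewrite -og_subr_gt0 -[RHS]og_subr_gt0.
  by have [|//] := gp (psi1 u - psi1 y1) (psi2 v - psi2 y2); apply: adB => //; apply: cl.
have leE : (u <= 0) = (v <= 0) by rewrite !og_leNgt gt.
rewrite ltE leE in i1 i1'.
by split => [/i1/i2'|/i2/i1'].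
Qed.

(** Closure under integration turns [P] into order: with a = u', [P_der_add] makes membership of a +
    c y1 the condition u + c y1 < 0. *)
Lemma adjoin_psi_preimage g1 g2 y1 y2 : R (g1, g2) ->
  (forall a, dom a -> exists a', [/\ dom a', a' != 0 & der1 a' = a]) ->
  (forall a b, R (a, b) -> a != 0 -> psi1 a != g1) ->
  0 < y1 -> psi1 y1 = g1 -> 0 < y2 -> psi2 y2 = g2 ->
  partial_iso (adjoin y1 y2).
Proof.
move=> Rg dint npsi yp1 y1E yp2 y2E.
have y10 : y1 != 0 by rewrite gt_eqF.
have y20 : y2 != 0 by rewrite gt_eqF.
have npsi2 a b : R (a, b) -> a != 0 -> psi2 b != g2.
  move=> h a0; apply/eqP => E; have := piso_psi iR h a0; rewrite E => h'.
  by have := npsi _ _ h a0; rewrite (piso_eqr h' Rg) eqxx.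
apply: adjoin_iso; rewrite ?yp1 ?yp2//.
- move=> a b h a0; rewrite y1E y2E; split; [exact: npsi h a0|exact: npsi2 h a0|].
  by apply: piso_lt => //; apply: (piso_psi iR).
- by rewrite y1E y2E; apply: sub_adjoin.
move=> a b c h c0; have [|u [[v h'] u0 uE]] := dint a; first by exists b.
have v0 : v != 0 by rewrite -(piso_neq0 h').
have vE : der2 v = b.
  by have := piso_der h' u0; rewrite uE => /piso_eql/(_ h).
have [i1 i1'] : P1 (a + c *: y1) <-> u + c *: y1 < 0.
  rewrite -uE; apply: (P_der_add HT1) => // _.
  by rewrite (psiZ Hpsi1)// y1E eq_sym (npsi _ _ h').
have [i2 i2'] : P2 (b + c *: y2) <-> v + c *: y2 < 0.
  rewrite -vE; apply: (P_der_add HT2) => // _.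
  by rewrite (psiZ Hpsi2)// y2E eq_sym (npsi2 _ _ h').
have [|s0] := @adjoin_psi _ _ _ Hpsi1 u y1 c y10 c0.
  by rewrite y1E => _; apply: (npsi _ _ h').
have [|t0] := @adjoin_psi _ _ _ Hpsi2 v y2 c y20 c0.
  by rewrite y2E => _; apply: (npsi2 _ _ h').
rewrite u0 v0 y1E y2E (piso_lt (piso_psi iR h' u0) Rg) /= => hv hu.
have E : (u + c *: y1 < 0) = (v + c *: y2 < 0).
  rewrite !og_lt0//; congr (~~ _).
  case: ifP hv hu => _ [_ ->] [_ ->]; first by rewrite (piso_gt0 iR h').
  by rewrite !ov_scale_gt0// yp1 yp2.
by rewrite E in i1 i1'; split => [/i1/i2'|/i2/i1'].
Qed.

End Theory.

Lemma maximal_iso R0 : partial_iso R0 -> exists R, [/\ subset R0 R, partial_iso R,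
  (forall a, dom R a -> exists a', [/\ dom R a', a' != 0 & der1 a' = a]) &
  (forall a, dom R a -> P1 a -> exists a', [/\ dom R a', a' != 0 & psi1 a' = a])].
Proof.
move=> iR0.
pose good (R : set (G1 * G2)) := R = set0 \/ (subset R0 R /\ partial_iso R).
have [F Fgood Ftot|R [[RE|[sR iR]] Rmax]] := @Zorn_bigcup _ good.
- case: (pselect (exists2 X, F X & X <> set0)) => [[X0 FX0 X0n]|nex]; last first.
    left; apply/seteqP; split => // x [X FX Xx]; case: nex; exists X => // X0.
    by rewrite X0 in Xx.
  have goodX X : F X -> forall x, X x -> subset R0 X /\ partial_iso X.
    by move=> FX x Xx; case: (Fgood _ FX) => // XE; rewrite XE in Xx.
  have [sX0 iX0] : subset R0 X0 /\ partial_iso X0 by case: (Fgood _ FX0).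
  right; split.
    by move=> x /sX0 ?; exists X0.
  split.
  + by exists X0 => //; apply: (piso0 iX0).
  + move=> a b a' b' [X FX Xx] [Y FY Yy].
    have [_ iX] := goodX _ FX _ Xx; have [_ iY] := goodX _ FY _ Yy.
    case: (Ftot _ _ FX FY) => XY.
      by exists Y => //; apply: (pisoD iY) => //; apply: XY.
    by exists X => //; apply: (pisoD iX) => //; apply: XY.
  + move=> c a b [X FX Xx]; have [_ iX] := goodX _ FX _ Xx.
    by exists X => //; apply: (pisoZ iX).
  + by move=> a b [X FX Xx]; have [_ iX] := goodX _ FX _ Xx; apply: (piso_gt0 iX).
  + move=> a b [X FX Xx] a0; have [_ iX] := goodX _ FX _ Xx.
    by exists X => //; apply: (piso_psi iX).
  + by move=> a b [X FX Xx]; have [_ iX] := goodX _ FX _ Xx; apply: (piso_P iX).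
- have [] := Rmax R0; last by right; split => // x.
  by rewrite RE; split => [x []|/(_ _ (piso0 iR0))].
have ext y1 y2 : partial_iso (adjoin R y1 y2) -> R (y1, y2).
  move=> iA; apply: contrapT => nR; have [] := Rmax (adjoin R y1 y2).
    split; first exact: sub_adjoin.
    by move=> /(_ _ (mem_adjoin iR y1 y2)).
  by right; split => //; apply: subset_trans sR (@sub_adjoin _ _ _).
have dint a : dom R a -> exists a', [/\ dom R a', a' != 0 & der1 a' = a].
  move=> [b h]; apply: contrapT => nex.
  have [y1 y10 y1E] := closed_int HC1 a; have [y2 y20 y2E] := closed_int HC2 b.
  apply: nex; exists y1; split => //; exists y2; apply: contrapT => nR.
  apply: nR; apply: ext.
  case: (pselect (exists u v, [/\ R (u, v), u != 0 & der1 u = a])).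
    move=> [u [v [h' u0 uE]]].
    have v0 : v != 0 by rewrite -(piso_neq0 iR h').
    have uy : u = y1 by apply: (der_inj Hpsi1) => //; rewrite uE y1E.
    have vy : v = y2.
      apply: (der_inj Hpsi2) => //; rewrite y2E.
      by have := piso_der iR h' u0; rewrite uE => /(piso_eql iR)/(_ h).
    rewrite -uy -vy; suff -> : adjoin R u v = R by [].
    apply/seteqP; split; last exact: sub_adjoin.
    move=> _ [p [q [c [hp ->]]]]; apply: (pisoD iR) => //; exact: (pisoZ iR).
  move=> nex; apply: (adjoin_integral iR h) => // u v h' u0.
  by apply/eqP => uE; apply: nex; exists u, v.
exists R; split => // a [b h] Pa; apply: contrapT => nex.
have [y1 yp1 y1E] := closed_P HC1 Pa.
have [y2 yp2 y2E] := closed_P HC2 (proj1 (piso_P iR h) Pa).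
have Ry : R (y1, y2).
  apply: ext; apply: (adjoin_psi_preimage iR h) => // u v h' u0.
  by apply/eqP => uE; apply: nex; exists u; split => //; exists v.
by apply: nex; exists y1; split; [exists y2 | rewrite gt_eqF |].
Qed.

End PartialIso.

(** * Ultraproducts *)

Section Ultraproduct.
Variables (k : realFieldType) (I : Type) (U : set_system I).
Hypothesis UU : UltraFilter U.
#[local] Existing Instance UU.
Variable G : I -> orderedVectType k.

Lemma ultra_absurd (p q : I -> Prop) : U p -> U q -> ~ forall i, p i -> ~ q i.
Proof.
move=> Up Uq h; apply: (@filter_not_empty _ U).
by apply: filterS2 Up Uq => i pi qi; case: (h i pi qi).
Qed.

Lemma ultra_not (p : I -> Prop) : ~ U p <-> U (fun i => ~ p i).
Proof.
split; first by case: (in_ultra_setVsetC p UU).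
by move=> h1 h2; case: (ultra_absurd h2 h1) => i pi npi; apply: npi.
Qed.

Lemma ultra_or (p q : I -> Prop) : U (fun i => p i \/ q i) <-> U p \/ U q.
Proof.
split=> [h|[]]; last 2 first.
- by apply: filterS => i; left.
- by apply: filterS => i; right.
apply: contrapT => /not_orP[/ultra_not np /ultra_not nq].
by apply: (ultra_absurd (filterI np nq) h) => i [? ?] [].
Qed.

Lemma ultra_all (p : I -> Prop) : (forall i, p i) -> U p.
Proof. by move=> h; apply: filterS (filterT). Qed.

Let D := forall i, G i.

Definition ultra_eq (f g : D) := `[< U (fun i => f i = g i) >].

Lemma ultra_eq_refl : reflexive ultra_eq.
Proof. by move=> f; apply/asboolP/ultra_all. Qed.

Lemma ultra_eq_sym : symmetric ultra_eq.
Proof.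
by move=> f g; apply/asboolP/asboolP; apply: filterS => i ->.
Qed.

Lemma ultra_eq_trans : transitive ultra_eq.
Proof.
move=> f g h /asboolP fg /asboolP gh; apply/asboolP.
by apply: filterS2 fg gh => i -> ->.
Qed.

Canonical ultra_equiv :=
  EquivRel ultra_eq ultra_eq_refl ultra_eq_sym ultra_eq_trans.

Definition ultraprod : Type := {eq_quot ultra_equiv}%qT.

HB.instance Definition _ := Choice.on ultraprod.

Definition cls (f : D) : ultraprod := (\pi_({eq_quot ultra_equiv}) f)%qT.
Definition rep (x : ultraprod) : D := repr (x : {eq_quot ultra_equiv}%qT).

Lemma rep_cls x : cls (rep x) = x.
Proof. exact: reprK. Qed.

Lemma cls_eq f g : cls f = cls g <-> U (fun i => f i = g i).
Proof.
split; first by move/eqmodP/asboolP.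
by move=> h; apply/eqmodP/asboolP.
Qed.

Lemma rep_eq f : U (fun i => rep (cls f) i = f i).
Proof. by apply/cls_eq; rewrite rep_cls. Qed.

Definition u_zero := cls (fun i => 0).
Definition u_opp x := cls (fun i => - rep x i).
Definition u_add x y := cls (fun i => rep x i + rep y i).
Definition u_scale (c : k) x := cls (fun i => c *: rep x i).
Definition u_le x y := `[< U (fun i => rep x i <= rep y i) >].

Lemma u_oppE f : u_opp (cls f) = cls (fun i => - f i).
Proof. by apply/cls_eq; apply: filterS (rep_eq f) => i ->. Qed.

Lemma u_addE f g : u_add (cls f) (cls g) = cls (fun i => f i + g i).
Proof. by apply/cls_eq; apply: filterS2 (rep_eq f) (rep_eq g) => i -> ->. Qed.

Lemma u_scaleE c f : u_scale c (cls f) = cls (fun i => c *: f i).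
Proof. by apply/cls_eq; apply: filterS (rep_eq f) => i ->. Qed.

Lemma u_leE f g : u_le (cls f) (cls g) <-> U (fun i => f i <= g i).
Proof.
split=> [/asboolP|] h; first by apply: filterS3 (rep_eq f) (rep_eq g) h => i -> ->.
by apply/asboolP; apply: filterS3 (rep_eq f) (rep_eq g) h => i -> ->.
Qed.

Lemma u_addA : associative u_add.
Proof.
move=> x y z; rewrite -(rep_cls x) -(rep_cls y) -(rep_cls z) !u_addE.
by apply/cls_eq/ultra_all => i; rewrite addrA.
Qed.

Lemma u_addC : commutative u_add.
Proof.
move=> x y; rewrite -(rep_cls x) -(rep_cls y) !u_addE.
by apply/cls_eq/ultra_all => i; rewrite addrC.
Qed.

Lemma u_add0 : left_id u_zero u_add.
Proof.
move=> x; rewrite -(rep_cls x) /u_zero !u_addE.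
by apply/cls_eq/ultra_all => i; rewrite add0r.
Qed.

Lemma u_addN : left_inverse u_zero u_opp u_add.
Proof.
move=> x; rewrite -(rep_cls x) /u_zero u_oppE !u_addE.
by apply/cls_eq/ultra_all => i; rewrite addNr.
Qed.

HB.instance Definition _ :=
  GRing.isZmodule.Build ultraprod u_addA u_addC u_add0 u_addN.

Lemma cls0 : 0 = cls (fun i => 0). Proof. by []. Qed.
Lemma clsN f : - cls f = cls (fun i => - f i). Proof. exact: u_oppE. Qed.
Lemma clsD f g : cls f + cls g = cls (fun i => f i + g i).
Proof. exact: u_addE. Qed.

Lemma u_scaleA a b v : u_scale a (u_scale b v) = u_scale (a * b) v.
Proof.
rewrite -(rep_cls v) !u_scaleE.
by apply/cls_eq/ultra_all => i; rewrite scalerA.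
Qed.

Lemma u_scale1 : left_id 1 u_scale.
Proof.
move=> v; rewrite -(rep_cls v) !u_scaleE.
by apply/cls_eq/ultra_all => i; rewrite scale1r.
Qed.

Lemma u_scaleDr : right_distributive u_scale +%R.
Proof.
move=> c u v; rewrite -(rep_cls u) -(rep_cls v) !(clsD, u_scaleE).
by apply/cls_eq/ultra_all => i; rewrite scalerDr.
Qed.

Lemma u_scaleDl v : {morph u_scale^~ v : a b / a + b}.
Proof.
move=> a b; rewrite -(rep_cls v) !(clsD, u_scaleE).
by apply/cls_eq/ultra_all => i; rewrite scalerDl.
Qed.

HB.instance Definition _ :=
  GRing.Zmodule_isLmodule.Build k ultraprod u_scaleA u_scale1 u_scaleDr u_scaleDl.

Lemma clsZ c f : c *: cls f = cls (fun i => c *: f i). Proof. exact: u_scaleE. Qed.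

Lemma u_le_refl : reflexive u_le.
Proof. by move=> x; apply/asboolP/ultra_all. Qed.

Lemma u_le_anti : antisymmetric u_le.
Proof.
move=> x y /andP[/asboolP xy /asboolP yx]; rewrite -(rep_cls x) -(rep_cls y).
by apply/cls_eq; apply: filterS2 xy yx => i h1 h2; apply/le_anti/andP.
Qed.

Lemma u_le_trans : transitive u_le.
Proof.
move=> x y z /asboolP xy /asboolP yz; apply/asboolP.
by apply: filterS2 xy yz => i; apply: le_trans.
Qed.

HB.instance Definition _ :=
  Order.Le_isPOrder.Build ring_display ultraprod u_le_refl u_le_anti u_le_trans.

Lemma cls_le f g : cls f <= cls g <-> U (fun i => f i <= g i).
Proof. exact: u_leE. Qed.

Lemma cls_lt f g : cls f < cls g <-> U (fun i => f i < g i).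
Proof.
split=> [|h].
  rewrite lt_neqAle => /andP[/eqP ne /cls_le le].
  have /ultra_not ne' : ~ U (fun i => f i = g i) by move/cls_eq.
  apply: filterS2 le ne' => i le' ne'.
  by rewrite lt_neqAle le' andbT; apply/eqP.
rewrite lt_neqAle; apply/andP; split.
  by apply/eqP => /cls_eq E; apply: (ultra_absurd E h) => i ->; rewrite ltxx.
by apply/cls_le; apply: filterS h => i /ltW.
Qed.

Lemma cls_neq0 f : cls f != 0 <-> U (fun i => f i != 0).
Proof.
split=> [/eqP h|h].
  have /ultra_not : ~ U (fun i => f i = 0) by move/cls_eq.
  by apply: filterS => i /eqP.
by apply/eqP => /cls_eq E; apply: (ultra_absurd E h) => i ->; rewrite eqxx.
Qed.

Lemma u_le_total (x y : ultraprod) : (x <= y) || (y <= x).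
Proof.
rewrite -(rep_cls x) -(rep_cls y); apply/orP.
have /ultra_or : U (fun i => rep x i <= rep y i \/ rep y i <= rep x i).
  by apply: ultra_all => i; apply/orP; apply: le_total_group.
by case=> h; [left|right]; apply/cls_le.
Qed.

Lemma u_translate (x y z : ultraprod) : x <= y -> z + x <= z + y.
Proof.
rewrite -(rep_cls x) -(rep_cls y) -(rep_cls z) => /cls_le h.
by rewrite !clsD; apply/cls_le; apply: filterS h => i; apply: ler_translate.
Qed.

HB.instance Definition _ :=
  POrderedZmodule_isOrderedGroup.Build ultraprod u_le_total u_translate.

Lemma u_scale_pos (c : k) (x : ultraprod) : 0 < c -> 0 < x -> 0 < c *: x.
Proof.
rewrite -(rep_cls x) cls0 => c0 /cls_lt h; rewrite clsZ; apply/cls_lt.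
by apply: filterS h => i; apply: scaler_pos.
Qed.

HB.instance Definition _ := Lmodule_isOrderedVect.Build k ultraprod u_scale_pos.

Variable psi : forall i, G i -> G i.
Variable P : forall i, set (G i).
Hypothesis closedG : forall i, closed_H_triple (@psi i) (@P i).

Definition u_psi (x : ultraprod) := cls (fun i => psi (rep x i)).
Definition u_P : set ultraprod := fun x => U (fun i => P (rep x i)).

Lemma u_psiE f : u_psi (cls f) = cls (fun i => psi (f i)).
Proof. by apply/cls_eq; apply: filterS (rep_eq f) => i ->. Qed.

Lemma u_PE f : u_P (cls f) <-> U (fun i => P (f i)).
Proof. by split=> h; apply: filterS2 (rep_eq f) h => i ->. Qed.

Let Hc i := H_couple_over_couple (H_triple_couple (proj1 (closedG i))).

Lemma cls_surj (x : ultraprod) : exists f, cls f = x.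
Proof. by exists (rep x); rewrite rep_cls. Qed.

Lemma cls_min_le f g h : Order.min (cls f) (cls g) <= cls h <->
  U (fun i => Order.min (f i) (g i) <= h i).
Proof.
have minE (V : orderedZmodType) (x y z : V) : Order.min x y <= z <-> x <= z \/ y <= z.
  rewrite minElt; case: ifP => xy; split; [by left| | by right|].
    by case=> // yz; apply: le_trans (ltW xy) yz.
  by case=> // xz; apply: le_trans xz; rewrite og_leNgt xy.
rewrite minE !cls_le -ultra_or; split; apply: filterS => i; first by move/minE.
by move/minE.
Qed.

Lemma cls_mulz f (m : int) : cls f *~ m = cls (fun i => f i *~ m).
Proof.
have nat_case n : cls f *+ n = cls (fun i => f i *+ n).
  elim: n => [|n IH]; first by rewrite mulr0n.
  by rewrite mulrS IH clsD; apply/cls_eq/ultra_all => i; rewrite mulrS.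
by case: m => n; [|rewrite !NegzE !mulrNz -clsN]; rewrite -?pmulrn nat_case.
Qed.

Lemma u_H_couple : H_couple_over u_psi.
Proof.
split; first split.
- move=> x y; case: (cls_surj x) (cls_surj y) => f <- [g <-].
  rewrite !clsD !u_psiE => /cls_neq0 f0 /cls_neq0 g0 /cls_neq0 fg0.
  by apply/cls_min_le; apply: filterS3 f0 g0 fg0 => i; apply: AC1 (Hc i) _ _.
- move=> x m; case: (cls_surj x) => f <- /cls_neq0 f0 m0.
  rewrite cls_mulz !u_psiE; apply/cls_eq.
  by apply: filterS f0 => i fi0; apply: (AC2 (Hc i)).
- move=> x y; case: (cls_surj x) (cls_surj y) => f <- [g <-].
  rewrite !u_psiE clsD cls0 => /cls_neq0 f0 /cls_neq0 g0 /cls_lt fp; apply/cls_lt.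
  by apply: filterS3 f0 g0 fp => i; apply: (AC3 (Hc i)).
- move=> x y; case: (cls_surj x) (cls_surj y) => f <- [g <-].
  rewrite !u_psiE cls0 => /cls_neq0 f0 /cls_neq0 g0 /cls_lt fp /cls_le fg.
  apply/cls_le; apply: filterS3 f0 g0 (filterI fp fg) => i f0 g0 [fp' fg'].
  exact: (HC (Hc i)).
- move=> c x; case: (cls_surj x) => f <- c0 /cls_neq0 f0.
  rewrite clsZ !u_psiE; apply/cls_eq; apply: filterS f0 => i fi0.
  exact: (H_couple_over_scale (H_triple_couple (proj1 (closedG i)))).
Qed.

(** Closedness involves quantifiers, so it is lifted by choosing witnesses in every factor. *)
Lemma u_closed : closed_H_triple u_psi u_P.
Proof.
have int_ex (g : ultraprod) : exists2 u, u != 0 & u + u_psi u = g.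
  case: (cls_surj g) => f <-.
  have ex i : exists v : G i, v != 0 /\ v + psi v = f i.
    by have [v v0 vE] := closed_int (closedG i) (f i); exists v.
  pose v i := projT1 (cid (ex i)); have hv i := projT2 (cid (ex i)).
  exists (cls v); first by apply/cls_neq0/ultra_all => i; case: (hv i).
  by rewrite u_psiE clsD; apply/cls_eq/ultra_all => i; case: (hv i).
have P_ex (g : ultraprod) : u_P g -> exists2 u, u != 0 & u_psi u = g.
  case: (cls_surj g) => f <- /u_PE Pf.
  have ex i : exists v : G i, P (f i) -> v != 0 /\ psi v = f i.
    case: (pselect (P (f i))) => [Pfi|]; last by exists 0.
    by have [v v0 vE] := closed_P (closedG i) Pfi; exists v; rewrite gt_eqF.
  pose v i := projT1 (cid (ex i)); have hv i := projT2 (cid (ex i)).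
  exists (cls v); first by apply/cls_neq0; apply: filterS Pf => i /hv[].
  by rewrite u_psiE; apply/cls_eq; apply: filterS Pf => i /hv[].
have P_psi' : subset (Psi u_psi) u_P.
  move=> _ [x x0 <-]; case: (cls_surj x) x0 => f <- /cls_neq0 f0.
  rewrite u_psiE; apply/u_PE; apply: filterS f0 => i.
  exact: (P_psi (proj1 (closedG i))).
have P_down' : downward_closed u_P.
  move=> x y; case: (cls_surj x) (cls_surj y) => f <- [g <-].
  move=> /u_PE Pg /cls_le fg; apply/u_PE; apply: filterS2 Pg fg => i.
  exact: (P_down (proj1 (closedG i))).
split; last split.
- split; first exact: u_H_couple.
  split => // p _ Pp [x xp <-]; case: (cls_surj p) (cls_surj x) Pp xp => f <- [g <-].
  rewrite /positive /= cls0 u_psiE clsD => /u_PE Pf /cls_lt gp; apply/cls_lt.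
  by apply: filterS2 Pf gp => i Pfi gi; apply: (nP_der (proj1 (closedG i))).
- move=> n g n0; exists ((n%:R^-1 : k) *: g).
  by rewrite -scaler_nat scalerA divff ?scale1r// pnatr_eq0 -lt0n.
(* Downward closure passes from [u_P] to Psi, as [P_ex] gives each element of [u_P] a
   psi-preimage. *)
- move=> x y /P_psi' Py xy; have [u u0 uE] := P_ex x (P_down' _ _ Py xy).
  by exists u.
- apply/seteqP; split => // g _; have [u u0 uE] := int_ex g.
  by exists u.
Qed.

Local Notation N i := (H_structure (@psi i) (@P i)).
Local Notation M := (H_structure u_psi u_P).

(** The limit of a family along U; in the second branch the default 0 is met only on a set outside
    U. *)
Definition u_lim (w : forall i, option (G i)) : option ultraprod :=
  if pselect (U (fun i => w i = None)) then None
  else Some (cls (fun i => odflt 0 (w i))).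

Lemma u_limP w u :
  u_lim w = u <-> U (fun i => w i = omap (fun x => rep x i) u).
Proof.
rewrite /u_lim; case: pselect => [h|nh] /=.
  split => [<-//|]; case: u => // x h'.
  by case: (ultra_absurd h h') => i /= ->.
have h : U (fun i => w i = Some (odflt 0 (w i))).
  by move/ultra_not: nh; apply: filterS => i; case: (w i).
case: u => [x|]; split.
- move=> [<-]; apply: filterS2 h (rep_eq (fun i => odflt 0 (w i))) => i /= hi E.
  by rewrite E -hi.
- move=> h'; congr Some; rewrite -(rep_cls x); apply/cls_eq.
  by apply: filterS h' => i /= ->.
- by [].
- by move=> h'; case: (ultra_absurd h h') => i /= ->.
Qed.

Lemma u_lim_ex (u : option ultraprod) : exists w, u_lim w = u.
Proof.
exists (fun i => omap (fun x => rep x i) u); apply/u_limP; exact: ultra_all.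
Qed.

Lemma u_lim_rep w : U (fun i => w i = omap (fun x => rep x i) (u_lim w)).
Proof. exact/u_limP. Qed.

Lemma u_eval n (t : term k n) (v : forall i, 'I_n -> N i) :
  eval (fun j => u_lim (fun i => v i j) : M) t = u_lim (fun i => eval (v i) t).
Proof.
apply/esym/u_limP; elim: t => /=.
- by move=> j; apply: u_lim_rep.
- by apply: filterS (rep_eq (fun i => 0)) => i ->.
- exact: ultra_all.
- move=> t; case: (eval _ t) => [x|] /=; last by apply: filterS => i ->.
  move=> h; apply: filterS2 h (rep_eq (fun i => - rep x i)) => i -> /= <-.
  by rewrite -clsN rep_cls.
- move=> t + t'; case: (eval _ t) => [x|] /=; last by move=> h _; apply: filterS h => i ->.
  case: (eval _ t') => [y|] h /= h'; last by apply: filterS2 h h' => i -> ->.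
  apply: filterS3 h h' (rep_eq (fun i => rep x i + rep y i)) => i -> ->.
  by rewrite /add_infty /= -clsD !rep_cls => ->.
- move=> c t; case: (eval _ t) => [x|] /=; last by apply: filterS => i ->.
  move=> h; apply: filterS2 h (rep_eq (fun i => c *: rep x i)) => i -> /= <-.
  by rewrite -clsZ rep_cls.
- move=> t; case: (eval _ t) => [x|] /=; last by apply: filterS => i ->.
  move=> h; have [x0|x0] /= := eqVneq x 0.
    have h0 : U (fun i => rep x i = 0) by apply/cls_eq; rewrite rep_cls.
    by apply: filterS2 h h0 => i -> /= ->; rewrite eqxx.
  have h0 : U (fun i => rep x i != 0) by apply/cls_neq0; rewrite rep_cls.
  apply: filterS3 h h0 (rep_eq (fun i => psi (rep x i))) => i -> /= /negbTE -> <-.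
  by rewrite /u_psi.
Qed.

Lemma los n (f : formula k n) (v : forall i, 'I_n -> N i) : quantifier_free f ->
  sat f (fun j => u_lim (fun i => v i j) : M) <-> U (fun i => sat f (v i)).
Proof.
elim: f v => //=.
- move=> {}n v _; split => // h; apply: (@filter_not_empty _ U).
  by apply: filterS h.
- move=> {}n t t' v _; rewrite !u_eval.
  have h := u_lim_rep (fun i => @eval _ (N i) _ (v i) t).
  split => [E|E].
    have h' := u_lim_rep (fun i => @eval _ (N i) _ (v i) t').
    by rewrite -E in h'; apply: filterS2 h h' => i -> ->.
  by apply/esym/u_limP; apply: filterS2 h E => i <- <-.
- move=> {}n t t' v _; rewrite !u_eval.
  have h := u_lim_rep (fun i => @eval _ (N i) _ (v i) t).
  have h' := u_lim_rep (fun i => @eval _ (N i) _ (v i) t').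
  case: (u_lim _) h => [x|] h; case: (u_lim _) h' => [y|] h' /=.
  + rewrite -{1}(rep_cls x) -{1}(rep_cls y) cls_lt.
    by split => lt; apply: filterS3 h h' lt => i -> ->.
  + by split => // _; apply: filterS2 h h' => i -> ->.
  + split => // lt; by case: (ultra_absurd (filterI h h') lt) => i [-> ->].
  + split => // lt; by case: (ultra_absurd (filterI h h') lt) => i [-> ->].
- move=> {}n t v _; rewrite !u_eval.
  have h := u_lim_rep (fun i => @eval _ (N i) _ (v i) t).
  case: (u_lim _) h => [x|] h /=.
    by split => Px; apply: filterS2 h Px => i ->.
  split => // Px; by case: (ultra_absurd h Px) => i ->.
- by move=> {}n f IH v qf; rewrite IH// ultra_not.
- move=> {}n f IHf g IHg v /andP[qf qg]; rewrite IHf// IHg//.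
  by split=> [[]|h]; [exact: filterI | split; apply: filterS h => i []].
- by move=> {}n f IHf g IHg v /andP[qf qg]; rewrite IHf// IHg// ultra_or.
- move=> {}n f IHf g IHg v /andP[qf qg]; rewrite IHf// IHg//.
  split=> [h|h hf]; last by apply: filterS2 h hf => i; apply.
  case: (pselect (U (fun i => @sat _ (N i) _ f (v i)))) => [/h|/ultra_not].
    by apply: filterS => i ? _.
  by apply: filterS.
Qed.

End Ultraproduct.

(** * Quantifier elimination *)

Section Transfer.
Variables (k : realFieldType).
Variables (G1 : orderedVectType k) (psi1 : G1 -> G1) (P1 : set G1).
Variables (G2 : orderedVectType k) (psi2 : G2 -> G2) (P2 : set G2).
Hypothesis cl1 : closed_H_triple psi1 P1.
Hypothesis cl2 : closed_H_triple psi2 P2.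
Local Notation M1 := (H_structure psi1 P1).
Local Notation M2 := (H_structure psi2 P2).

Definition rel_infty (R : set (G1 * G2)) (u : option G1) (v : option G2) :=
  match u, v with
  | Some a, Some b => R (a, b)
  | None, None => True
  | _, _ => False
  end.

Lemma piso_eval R n (t : term k n) (v1 : 'I_n -> M1) (v2 : 'I_n -> M2) :
  partial_iso psi1 P1 psi2 P2 R -> (forall i, rel_infty R (v1 i) (v2 i)) ->
  rel_infty R (eval v1 t) (eval v2 t).
Proof.
move=> iR hv; elim: t => //=.
- exact: piso0 iR.
- move=> t; case: (eval v1 t) (eval v2 t) => [a|] [b|] //=.
  exact: pisoN iR _ _.
- move=> t + t'; case: (eval v1 t) (eval v2 t) => [a|] [b|] //=;
  case: (eval v1 t') (eval v2 t') => [a'|] [b'|] //= h h'.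
  exact: (pisoD iR).
- move=> c t; case: (eval v1 t) (eval v2 t) => [a|] [b|] //=.
  exact: pisoZ iR _ _ _.
- move=> t; case: (eval v1 t) (eval v2 t) => [a|] [b|] //= h.
  have := piso_neq0 iR h; case: eqVneq => [_|a0]; case: eqVneq => // _ _.
  exact: (piso_psi iR).
Qed.

Lemma piso_sat R n (f : formula k n) (v1 : 'I_n -> M1) (v2 : 'I_n -> M2) :
  partial_iso psi1 P1 psi2 P2 R -> quantifier_free f ->
  (forall i, rel_infty R (v1 i) (v2 i)) -> sat f v1 <-> sat f v2.
Proof.
move=> iR; elim: f v1 v2 => {n}.
- by [].
- move=> n t t' v1 v2 _ hv.
  have := piso_eval t iR hv; have := piso_eval t' iR hv; move=> /=.
  case: (eval v1 t) (eval v2 t) => [a|] [b|] //=;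
  case: (eval v1 t') (eval v2 t') => [a'|] [b'|] //= h h'.
  split => -[E]; congr Some; move: h'; rewrite E => h'.
    exact: piso_eql iR _ _ _ h' h.
  exact: piso_eqr iR _ _ _ h' h.
- move=> n t t' v1 v2 _ hv.
  have := piso_eval t iR hv; have := piso_eval t' iR hv; move=> /=.
  case: (eval v1 t) (eval v2 t) => [a|] [b|] //=;
  case: (eval v1 t') (eval v2 t') => [a'|] [b'|] //= h h'.
  by rewrite (piso_lt iR h' h).
- move=> n t v1 v2 _ hv; have := piso_eval t iR hv; move=> /=.
  by case: (eval v1 t) (eval v2 t) => [a|] [b|] //=; exact: piso_P iR _ _.
- by move=> n f IH v1 v2 /= qf hv; rewrite (IH v1 v2).
1-3: move=> n f IHf g IHg v1 v2 /= /andP[qf qg] hv.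
1-3: by rewrite (IHf v1 v2)// (IHg v1 v2).
- by [].
- by [].
Qed.

(** The isomorphism of the generated substructures sends the value of a term at v1 to its value at
    v2; infinite values drop out. *)
Lemma type_iso n (v1 : 'I_n -> M1) (v2 : 'I_n -> M2) :
  (forall g : formula k n, quantifier_free g -> sat g v1 <-> sat g v2) ->
  partial_iso psi1 P1 psi2 P2
    [set u | exists t, eval v1 t = Some u.1 /\ eval v2 t = Some u.2].
Proof.
move=> E; split.
- by exists (Zero k n).
- move=> a b a' b' [t [/= t1 t2]] [t' [/= t1' t2']].
  by exists (Add t t'); rewrite /= t1 t2 t1' t2'.
- by move=> c a b [t [/= t1 t2]]; exists (Scale c t); rewrite /= t1 t2.
- move=> a b [t [/= t1 t2]]; have := E (Lt (Zero k n) t) isT.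
  by rewrite /= t1 t2 /= => h; apply/idP/idP => /h.
- move=> a b [t [/= t1 t2]] a0; exists (PsiT t); rewrite /= t1 t2 /=.
  have := E (Eq t (Zero k n)) isT; rewrite /= t1 t2 (negbTE a0).
  case: eqVneq => // -> [_ /(_ erefl)[a00]].
  by rewrite a00 eqxx in a0.
- by move=> a b [t [/= t1 t2]]; have := E (InP t) isT; rewrite /= t1 t2.
Qed.

Lemma transfer n (f : formula k n.+1) (v1 : 'I_n -> M1) (v2 : 'I_n -> M2) :
  quantifier_free f ->
  (forall g : formula k n, quantifier_free g -> sat g v1 <-> sat g v2) ->
  sat (Ex f) v1 -> sat (Ex f) v2.
Proof.
move=> qf E /= [x fx].
have [R [sR iR dint dPsi]] := maximal_iso cl1 cl2 (type_iso E).
have hv i : rel_infty R (v1 i) (v2 i).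
  (* This formula matches the infinite entries of the two tuples. *)
  have h := E (Eq (Var k i) (Infty k n)) isT; move: h => /=.
  case e1: (v1 i) => [a|]; case e2: (v2 i) => [b|] //=.
  - by move=> _; apply: sR; exists (Var k i).
  - by case=> _ /(_ erefl).
  - by case=> /(_ erefl).
have Av i : in_infty (dom R) (v1 i).
  by have := hv i; case: (v1 i) (v2 i) => [a|] [b|] //= h; exists b.
have [y Ay fy] := existentially_closed (proj1 cl1) (closed_int cl1)
  (dom_subspace iR) (@dom_psi _ _ _ _ _ _ _ _ iR) dint dPsi qf Av fx.
have [z yz] : exists z, rel_infty R y z.
  by case: y Ay {fy} => [a [b h]|_]; [exists (Some b) | exists None].
exists z; apply/(@piso_sat R _ f (extend y v1) (extend z v2)) => // i.
by rewrite /extend; case: unliftP.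
Qed.

End Transfer.

(** * Compactness and induction on formulas *)

Section QuantifierElimination.
Variable k : realFieldType.

Record point n := Point {
  point_group : orderedVectType k;
  point_psi : point_group -> point_group;
  point_P : set point_group;
  point_closed : closed_H_triple point_psi point_P;
  point_val : 'I_n -> H_structure point_psi point_P
}.

Definition at_point n (p : point n) (f : formula k n) := sat f (@point_val n p).

(** A decision tree over s: X and Y are split according to g, so that two points in the same part
    are separated by a remaining formula. *)
Lemma separation n (s : seq {classic (formula k n)}) (X Y : point n -> Prop) :
  (forall p q, X p -> Y q -> exists2 g, g \in s &
     quantifier_free g /\ ~ (at_point p g <-> at_point q g)) ->
  exists2 h : formula k n, quantifier_free h &
    (forall p, X p -> at_point p h) /\ (forall q, Y q -> ~ at_point q h).
Proof.
elim: s X Y => [|g s IH] X Y sep.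
  case: (pselect (exists p, X p)) => [[p Xp]|nX].
    exists (Not (Bot k n)) => //; split; first by move=> ? _ [].
    by move=> q Yq; have [] := sep p q Xp Yq.
  by exists (Bot k n) => //; split => [p Xp|q _ []]; case: nX; exists p.
case: (boolP (quantifier_free g)) => qg; last first.
  apply: IH => p q Xp Yq; have [h] := sep p q Xp Yq.
  rewrite inE => /orP[/eqP-> []|hs hpq]; last by exists h.
  by rewrite (negbTE qg).
have [|h1 qh1 [X1 Y1]] := IH (fun p => X p /\ at_point p g)
  (fun p => Y p /\ at_point p g).
  move=> p q [Xp pg] [Yq qg']; have [h] := sep p q Xp Yq.
  by rewrite inE => /orP[/eqP-> [_ []]//|hs hpq]; exists h.
have [|h2 qh2 [X2 Y2]] := IH (fun p => X p /\ ~ at_point p g)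
  (fun p => Y p /\ ~ at_point p g).
  move=> p q [Xp pg] [Yq qg']; have [h] := sep p q Xp Yq.
  by rewrite inE => /orP[/eqP-> [_ []]//|hs hpq]; exists h.
exists (Or (And g h1) (And (Not g) h2)); first by rewrite /= qg qh1 qh2.
split=> p.
- move=> Xp; case: (pselect (at_point p g)) => pg; [left|right].
    by split => //; apply: X1.
  by split => //; apply: X2.
- by move=> Yp [[pg ph]|[pg ph]]; [apply: (Y1 p) | apply: (Y2 p)].
Qed.

Definition uniform_equiv n (f g : formula k n) :=
  forall (G : orderedVectType k) (psi : G -> G) (P : set G),
    closed_H_triple psi P ->
    forall v : 'I_n -> H_structure psi P, sat f v <-> sat g v.

Section Compactness.
Variables (n : nat) (f : formula k n.+1).
Hypothesis qf : quantifier_free f.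

Let I := seq {classic (formula k n)}.

(** Along any finer ultrafilter, each formula eventually belongs to s. *)
Definition cone_filter : set_system I :=
  fun A => exists s0 : I, forall s : I, {subset s0 <= s} -> A s.

Lemma cone_filter_proper : ProperFilter cone_filter.
Proof.
split; first by move=> [s0 /(_ s0)]; apply.
split.
- by exists [::].
- move=> A B [s1 h1] [s2 h2]; exists (s1 ++ s2) => s sub; split.
    by apply: h1 => g gs; apply: sub; rewrite mem_cat gs.
  by apply: h2 => g gs; apply: sub; rewrite mem_cat gs orbT.
- by move=> A B AB [s0 h]; exists s0 => s /h /AB.
Qed.

Lemma extend_lim (J : Type) (U : set_system J) (UU : UltraFilter U)
    (G : J -> orderedVectType k) (w : forall i, option (G i))
    (v : forall i, 'I_n -> option (G i)) :
  extend (u_lim UU w) (fun j => u_lim UU (fun i => v i j)) =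
  fun j => u_lim UU (fun i => extend (w i) (v i) j).
Proof. by apply/funext => j; rewrite /extend; case: unliftP. Qed.

(** Without an equivalent g, [separation] yields for each finite s two points that agree on the
    quantifier-free formulas of s but not on [Ex f]. Their ultraproducts agree on all
    quantifier-free formulas and still differ on [Ex f], against [transfer]. *)
Lemma eliminate_Ex : exists2 g : formula k n,
  quantifier_free g & uniform_equiv (Ex f) g.
Proof.
apply: contrapT => nex.
have ex (s : I) : exists pq : point n * point n,
    [/\ at_point pq.1 (Ex f), ~ at_point pq.2 (Ex f) &
        forall g, g \in s -> quantifier_free g ->
          at_point pq.1 g <-> at_point pq.2 g].
  apply: contrapT => nexs.
  have [|g qg [gX gY]] := @separation n s (fun p => at_point p (Ex f))
    (fun q => ~ at_point q (Ex f)).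
    move=> p q Xp Yq; apply: contrapT => nsep; apply: nexs; exists (p, q).
    split => // g gs qg; apply: contrapT => npq; apply: nsep; exists g => //.
  apply: nex; exists g => // G psi P cl v; split.
    by move=> fv; apply: (gX (Point cl v)).
  by move=> gv; apply: contrapT => nf; apply: (gY (Point cl v)).
pose p s := (projT1 (cid (ex s))).1; pose q s := (projT1 (cid (ex s))).2.
have fp s : at_point (p s) (Ex f) by case: (projT2 (cid (ex s))).
have fq s : ~ at_point (q s) (Ex f) by case: (projT2 (cid (ex s))).
have pq (s : I) (g : {classic (formula k n)}) : g \in s -> quantifier_free g -> at_point (p s) g <-> at_point (q s) g.
  by case: (projT2 (cid (ex s))) => _ _; apply.
have [U [UU sU]] := ultraFilterLemma cone_filter_proper.
have clp := u_closed UU (fun s => point_closed (p s)).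
have clq := u_closed UU (fun s => point_closed (q s)).
pose Mp := H_structure (@u_psi _ _ _ UU _ (fun s => @point_psi n (p s)))
  (@u_P _ _ _ UU _ (fun s => @point_P n (p s))).
pose Mq := H_structure (@u_psi _ _ _ UU _ (fun s => @point_psi n (q s)))
  (@u_P _ _ _ UU _ (fun s => @point_P n (q s))).
pose vp j := u_lim UU (fun s => point_val (p s) j).
pose vq j := u_lim UU (fun s => point_val (q s) j).
have typ (g : formula k n) : quantifier_free g ->
    @sat _ Mp _ g vp <-> @sat _ Mq _ g vq.
  move=> qg.
  have Ug : U (fun s => at_point (p s) g <-> at_point (q s) g).
    apply: sU; exists [:: (g : {classic (formula k n)})] => s sub.
    by apply: pq => //; apply: sub; rewrite mem_head.
  have lp := los UU (fun s => point_val (p s)) qg.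
  have lq := los UU (fun s => point_val (q s)) qg.
  apply: (iff_trans lp); apply: (iff_trans _ (iff_sym lq)).
  split => h; last by apply: filterS2 Ug h => s [].
  by apply: filterS2 Ug h => s [].
have [|y] := transfer clp clq (v1 := vp) (v2 := vq) qf typ.
  pose x s := projT1 (cid (fp s)); have hx s := projT2 (cid (fp s)).
  exists (u_lim UU x); rewrite extend_lim.
  apply/(los UU (fun s => extend (x s) (point_val (p s))) qf).
  by apply: ultra_all => s; apply: hx.
have [w <-] := u_lim_ex y; rewrite extend_lim.
move/(los UU (fun s => extend (w s) (point_val (q s))) qf) => Uf.
apply: (@filter_not_empty _ U); apply: filterS Uf => s fs.
by apply: (fq s); exists (w s).
Qed.

End Compactness.

Lemma uniform_elimination n (f : formula k n) : exists2 g : formula k n,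
  quantifier_free g & uniform_equiv f g.
Proof.
elim: f => {n}.
- by move=> n; exists (Bot k n).
- by move=> n t u; exists (Eq t u).
- by move=> n t u; exists (Lt t u).
- by move=> n t; exists (InP t).
- by move=> n f [g qg fg]; exists (Not g) => // G psi P cl v /=; rewrite fg.
- move=> n f1 [g1 q1 e1] f2 [g2 q2 e2]; exists (And g1 g2); first exact/andP.
  by move=> G psi P cl v /=; rewrite e1// e2.
- move=> n f1 [g1 q1 e1] f2 [g2 q2 e2]; exists (Or g1 g2); first exact/andP.
  by move=> G psi P cl v /=; rewrite e1// e2.
- move=> n f1 [g1 q1 e1] f2 [g2 q2 e2]; exists (Imp g1 g2); first exact/andP.
  by move=> G psi P cl v /=; rewrite e1// e2.
- move=> n f [g qg fg]; have [h qh gh] := eliminate_Ex qg; exists h => //.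
  move=> G psi P cl v; rewrite -gh//=.
  by split=> -[x hx]; exists x; apply/fg.
- move=> n f [g qg fg].
  have [h qh gh] := @eliminate_Ex n (Not g) qg; exists (Not h) => //.
  move=> G psi P cl v /=; rewrite -gh//=; split => [h1 [x]|h1 x].
    by rewrite -fg.
  by apply/fg => //; apply: contrapT => ng; apply: h1; exists x.
Qed.

(** [has_QE] speaks of all models of the theory, not only of closed triples; the equivalence of f
    and g therefore enters the theory as a sentence. *)
Fixpoint universal_closure n : formula k n -> sentence k :=
  match n with
  | 0 => id
  | n'.+1 => fun f => universal_closure (All f)
  end.

Lemma universal_closureP (M : structure k) n (f : formula k n) :
  Defs.holds M (universal_closure f) <-> forall v : 'I_n -> M, sat f v.
Proof.
elim: n f => [|n IH] f /=.
  split=> [h v|]; last exact.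
  by have -> : v = @no_var M by apply/funext => -[].
rewrite IH /=; split => h v; last by move=> a; apply: h.
have -> : v = extend (v ord0) (fun i => v (lift ord0 i)).
  by apply/funext => i; rewrite /extend; case: unliftP => [j|] ->.
exact: h.
Qed.

End QuantifierElimination.

Theorem theorem3p3 (k : realFieldType) : has_QE (@closed_H_triples_theory k).
Proof.
move=> n f; have [g qg fg] := uniform_elimination f.
exists g; split => // M MT v.
have /MT/universal_closureP/(_ v) : closed_H_triples_theory
    (universal_closure (And (Imp f g) (Imp g f))).
  move=> G psi P cl; apply/universal_closureP => w.
  by split=> /=; have [] := fg G psi P cl w.
by case.
Qed.
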